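(* Let $h$ be a convex normal integrand on $\mathbb{R}^n\times\Omega$ such that $\phi(0)$ is finite and $Eh$ is proper on $L^\infty$, where $\phi(z)=\inf_{x\in\mathcal N}Eh(x+z)$ for $z\in L^\infty$. Then for every $v\in L^1$ $$\phi^*(v)=Eh^*(v)+\delta_{\mathcal N^\perp}(v).$$ In particular, $v\in L^1$ is a shadow price of information (i.e. $\phi(z)\ge\phi(0)+E(z\cdot v)$ for all $z\in L^\infty$) if and only if $v$ solves the dual problem $$\text{minimize}\quad Eh^*(v)\quad\text{over } v\in\mathcal N^\perp$$ and the optimum value of this dual problem equals $-\phi(0)$. In this case (i.e. when $v$ is a shadow price of information), an $x\in\mathcal N$ is optimal for the problem of minimizing $Eh$ over $\mathcal N$ if and only if $Eh(x)<\infty$ and, for almost every $\omega$, $x(\omega)$ minimizes the function $\xi\mapsto h(\xi,\omega)-v(\omega)\cdot\xi$ over $\mathbb{R}^n$.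
   Context: $(\Omega,\mathcal F,P)$ is a probability space with a filtration $(\mathcal F_t)_{t=0}^T$ (sub-$\sigma$-algebras of $\mathcal F$; $\mathcal F_T$ need not equal $\mathcal F$), and $n=n_0+\cdots+n_T$. $L^p:=L^p(\Omega,\mathcal F,P;\mathbb{R}^n)$ for $p\in\{0,1,\infty\}$ ($L^0$ = equivalence classes of measurable functions). $\mathcal N=\{(x_t)_{t=0}^T \mid x_t\in L^0(\Omega,\mathcal F_t,P;\mathbb{R}^{n_t})\}$ is the space of adapted strategies, $\mathcal N^\infty:=\mathcal N\cap L^\infty$, and $\mathcal N^\perp:=\{v\in L^1\mid E(z\cdot v)=0\ \forall z\in\mathcal N^\infty\}$. A normal integrand is a function $h:\mathbb{R}^n\times\Omega\to[-\infty,\infty]$ such that $\omega\mapsto\{(\xi,\alpha)\mid h(\xi,\omega)\le\alpha\}$ is a closed-valued $\mathcal F$-measurable set-valued mapping; it is convex if $h(\cdot,\omega)$ is convex for every $\omega$. For $x\in L^0$, $h(x)$ denotes $\omega\mapsto h(x(\omega),\omega)$ and $Eh(x)$ its expectation, where the expectation of a measurable function is defined as $+\infty$ unless its positive part is integrable. ''$Eh$ is proper on $L^\infty$'' means that $Eh>-\infty$ on $L^\infty$ and $Eh(z)<\infty$ for some $z\in L^\infty$. $h^*(\cdot,\omega)$ is the pointwise convex conjugate $h^*(v,\omega)=\sup_{\xi\in\mathbb{R}^n}\{\xi\cdot v-h(\xi,\omega)\}$. The conjugate of $\phi$ is $\phi^*(v)=\sup_{z\in L^\infty}\{E(z\cdot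 v)-\phi(z)\}$ for $v\in L^1$. $\delta_C$ is the indicator function of $C$ ($0$ on $C$, $+\infty$ outside). *)

(* Defs.v *)
From HB Require Import structures.
From mathcomp Require Export all_boot all_order all_algebra.
From mathcomp Require Export all_classical all_reals all_analysis.

Set Implicit Arguments.
Unset Strict Implicit.
Unset Printing Implicit Defensive.

Import Order.TTheory GRing.Theory Num.Theory.
Import numFieldNormedType.Exports.

Local Open Scope classical_set_scope.
Local Open Scope ring_scope.

Definition dot (R : realType) (m : nat) (u v : 'rV[R]_m) : R :=
  \sum_(j < m) u 0 j * v 0 j.

(* Elements of L^p spaces are represented by measurable functions, not by
   equivalence classes. *)
Section Spaces.
Context {d : measure_display} {Omega : measurableType d} {R : realType}.
Variable P : probability Omega R.

Definition random_vector (G : set (set Omega)) (m : nat)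
    (x : Omega -> 'rV[R]_m) : Prop :=
  forall (j : 'I_m) (B : set R), measurable B ->
    G ((fun w : Omega => x w 0 j : R) @^-1` B).

(* L^0(Omega, G, P; R^m) for a sub-sigma-algebra G, as a subspace of
   L^0(Omega, F, P; R^m): the F-measurable functions whose equivalence class
   contains a G-measurable function. *)
Definition L0 (G : set (set Omega)) (m : nat) : set (Omega -> 'rV[R]_m) :=
  [set x | random_vector measurable x /\
     exists2 y, random_vector G y & ae_eq P setT x y].

Definition Lp (p : \bar R) (m : nat) : set (Omega -> 'rV[R]_m) :=
  [set x : Omega -> 'rV[R]_m |
     forall j : 'I_m, (fun w : Omega => x w 0 j : R) \in Lfun P p].

(* The expectation is +oo unless the positive part is integrable; if the
   positive part is integrable but the negative part is not, it is -oo. *)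
Definition Ex (f : Omega -> \bar R) : \bar R :=
  if `[< P.-integrable setT (f^\+)%E >] then (\int[P]_w f w)%E else +oo%E.

Definition Edot (m : nat) (z v : Omega -> 'rV[R]_m) : \bar R :=
  Ex (fun w => (dot (z w) (v w))%:E).

End Spaces.

Arguments L0 {d Omega R} P G m.
Arguments Lp {d Omega R} P p m.

Section Integrands.
Context {d : measure_display} {Omega : measurableType d} {R : realType}
  {m : nat}.

Definition epigraph (h : 'rV[R]_m -> Omega -> \bar R) (w : Omega) :
    set ('rV[R]_m * R^o) :=
  [set p | (h p.1 w <= p.2%:E)%E].

Definition measurable_setvalued (X : topologicalType) (S : Omega -> set X) :=
  forall O : set X, open O -> measurable [set w | S w `&` O !=set0].

Definition normal_integrand (h : 'rV[R]_m -> Omega -> \bar R) :=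
  (forall w, closed (epigraph h w)) /\ measurable_setvalued (epigraph h).

(* An extended real-valued function is convex when its epigraph is. *)
Definition convex_integrand (h : 'rV[R]_m -> Omega -> \bar R) :=
  forall w, convex_set (epigraph h w).

Definition conj_integrand (h : 'rV[R]_m -> Omega -> \bar R) :
    'rV[R]_m -> Omega -> \bar R :=
  fun v w => ereal_sup [set ((dot xi v)%:E - h xi w)%E | xi in setT].

Definition Eint (P : probability Omega R) (h : 'rV[R]_m -> Omega -> \bar R)
    (x : Omega -> 'rV[R]_m) : \bar R :=
  Ex P (fun w => h (x w) w).

Definition proper_on_Linfty (P : probability Omega R)
    (h : 'rV[R]_m -> Omega -> \bar R) :=
  (forall z, Lp P +oo%E m z -> (-oo < Eint P h z)%E) /\
  (exists2 z, Lp P +oo%E m z & (Eint P h z < +oo)%E).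

Definition conjugate (P : probability Omega R)
    (phi : (Omega -> 'rV[R]_m) -> \bar R) (v : Omega -> 'rV[R]_m) : \bar R :=
  ereal_sup [set (Edot P z v - phi z)%E | z in Lp P +oo%E m].

Definition shadow_price (P : probability Omega R)
    (phi : (Omega -> 'rV[R]_m) -> \bar R) (v : Omega -> 'rV[R]_m) : Prop :=
  forall z, Lp P +oo%E m z -> (phi (cst 0%R) + Edot P z v <= phi z)%E.

End Integrands.

Definition indicator_fun (R : realType) (X : Type) (C : set X) (x : X) :
    \bar R :=
  if `[< C x >] then 0%E else +oo%E.

Definition minimizes (R : realType) (X : Type) (f : X -> \bar R) (C : set X)
    (x : X) : Prop :=
  C x /\ forall y, C y -> (f x <= f y)%E.

Section Strategies.
Context {d : measure_display} {Omega : measurableType d} {R : realType}.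
Variables (P : probability Omega R) (T : nat).
Variables (F : 'I_T.+1 -> set (set Omega)) (n : 'I_T.+1 -> nat).

Definition filtration : Prop :=
  [/\ forall t, sigma_algebra setT (F t),
      forall t, F t `<=` measurable &
      forall s t : 'I_T.+1, (s <= t)%N -> F s `<=` F t].

Local Notation vec := ('rV[R]_(\sum_t n t)).

(* submxrow (x w) t : 'rV_(n t) is the t-th block of x w. *)
Definition adapted : set (Omega -> vec) :=
  [set x | forall t, L0 P (F t) (n t) (fun w => submxrow (x w) t)].

Definition adapted_perp : set (Omega -> vec) :=
  [set v | Lp P 1%E _ v /\
     forall z, adapted z -> Lp P +oo%E _ z -> Edot P z v = 0%E].

Definition value_fun (h : vec -> Omega -> \bar R) (z : Omega -> vec) :
    \bar R :=
  ereal_inf [set Eint P h (fun w => x w + z w) | x in adapted].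

End Strategies.

Arguments adapted {d Omega R} P {T} F n.
Arguments adapted_perp {d Omega R} P {T} F n.
Arguments value_fun {d Omega R} P {T} F {n} h z.

(* Main.v *)
Require Import Defs.
From mathcomp Require Import all_boot all_order all_algebra.
From mathcomp Require Import all_classical all_reals all_analysis.
From mathcomp Require Import measurable_realfun ess_sup_inf hoelder.
From mathcomp Require Import lra.

(** The conjugate is computed by two inequalities.

    "At least": for bounded [z] one has [phi z <= Eh z], so it is enough to
    approximate [Eh*(v)] by [E(z . v) - Eh z].  The epigraph of [h] has a
    countable dense family of measurable selections (a Castaing representation),
    and [h*(v)] is the pointwise supremum of the dual gains of these selections.
    Truncating the selections and always keeping the better of two candidates
    gives bounded strategies whose gains increase to [h*(v)]; monotone
    convergence concludes.

    "At most": for [v] orthogonal to the bounded adapted strategies, the Fenchel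
    inequality bounds [((x + z) . v)^+] by an integrable function, and then
    [E((x + z) . v) = E(z . v)] even when the adapted [x] is unbounded.  If [v] is
    not orthogonal, translating along an adapted direction makes the conjugate
    infinite because [phi 0] is finite.

    The other claims are the equality cases of the Fenchel inequality. *)

Set Implicit Arguments.
Unset Strict Implicit.
Unset Printing Implicit Defensive.

Import Order.TTheory GRing.Theory Num.Theory.
Import numFieldNormedType.Exports.

Local Open Scope classical_set_scope.
Local Open Scope ring_scope.

(** * Measurable selections *)

Lemma measurable_set_Prop d (Omega : measurableType d) (A : Prop) :
  measurable [set w : Omega | A].
Proof.
have [a|na] := pselect A.
  by rewrite (_ : [set _ | _] = setT)//; apply/seteqP; split.
by rewrite (_ : [set _ | _] = set0)//; apply/seteqP; split.
Qed.

(** The fallback [i0] makes the choice total. [selection_index] later falls back on its previous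
    index, so it stays constant in [n] where [S w] is empty. *)
Definition first_index (Q : nat -> Prop) (i0 : nat) : nat :=
  if pselect (exists j, `[< Q j >]) is left e then ex_minn e else i0.

Lemma first_indexP (Q : nat -> Prop) i0 : (exists j, Q j) -> Q (first_index Q i0).
Proof.
move=> [j Qj]; rewrite /first_index; case: pselect => [e|[]].
  by case: ex_minnP => k /asboolP.
by exists j; apply/asboolP.
Qed.

Lemma first_index_default (Q : nat -> Prop) i0 :
  ~ (exists j, Q j) -> first_index Q i0 = i0.
Proof.
move=> nQ; rewrite /first_index; case: pselect => // e; exfalso.
by case: e => j /asboolP Qj; apply: nQ; exists j.
Qed.

Lemma measurable_first_index d (Omega : measurableType d)
    (Q : Omega -> nat -> Prop) i0 j :
  (forall i, measurable [set w | Q w i]) ->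
  measurable [set w | first_index (Q w) i0 = j].
Proof.
move=> mQ.
have -> : [set w | first_index (Q w) i0 = j] =
    ([set w | Q w j] `&` \bigcap_i [set w | (i < j)%N -> ~ Q w i]) `|`
    ((\bigcap_i ~` [set w | Q w i]) `&` [set w | i0 = j]).
  apply/seteqP; split => w /=.
    have [e|ne] := pselect (exists i, Q w i).
      rewrite /first_index; case: pselect => [e'|[]]; last first.
        by case: e => i Qi; exists i; apply/asboolP.
      case: ex_minnP => k /asboolP Qk kmin <-; left; split => // i _ ik Qi.
      by have := kmin i (asboolT Qi); rewrite leqNgt ik.
    rewrite first_index_default// => i0j; right; split => // i _ Qi.
    by apply: ne; exists i.
  move=> [[Qj nQ]|[nQ i0j]]; last first.
    by rewrite first_index_default// => -[i Qi]; exact: (nQ i).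
  rewrite /first_index; case: pselect => [e|[]]; last by exists j; apply/asboolP.
  case: ex_minnP => k /asboolP Qk kmin.
  apply/eqP; rewrite eqn_leq kmin ?(asboolT Qj)//= leqNgt.
  by apply/negP => kj; exact: (nQ k).
apply: measurableU; apply: measurableI => //; last exact: measurable_set_Prop.
  apply: bigcapT_measurable => i; have [ij|ij] := boolP (i < j)%N.
    rewrite (_ : [set _ | _] = ~` [set w | Q w i]); first exact: measurableC.
    by apply/seteqP; split => w /=; [exact|].
  by rewrite (_ : [set _ | _] = setT)//; apply/seteqP; split.
by apply: bigcapT_measurable => i; exact: measurableC.
Qed.

(** * Sequences with geometrically decreasing steps *)

Section DyadicSequences.
Context {R : realType}.

Definition dyadic (k : nat) : R := 2^-1 ^+ k.

Lemma dyadic_gt0 k : 0 < dyadic k. Proof. by rewrite exprn_gt0// invr_gt0. Qed.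

Lemma dyadicS k : dyadic k = 2 * dyadic k.+1.
Proof. by rewrite /dyadic exprS mulrA divff ?mul1r. Qed.

Lemma dyadic_small (e : R) : 0 < e -> \forall k \near \oo, dyadic k < e.
Proof.
move=> e0; have : `|2^-1 : R| < 1 by rewrite ger0_norm ?invr_ge0// invf_lt1// ltr1n.
move/cvg_expr => /cvgr0_norm_lt /(_ e e0).
by apply: filterS => k; rewrite ger0_norm// ltW// dyadic_gt0.
Qed.

(** The steps telescope. The subtracted [dyadic (n + k)] closes the induction: halving it frees
    exactly the bound on the next step. *)
Lemma dyadic_dist (V : normedModType R) (u : nat -> V) (c : R) n k :
  (forall n, `|u n - u n.+1| <= c * dyadic n) ->
  `|u n - u (n + k)%N| <= 2 * c * (dyadic n - dyadic (n + k)).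
Proof.
move=> uc; elim: k => [|k IH]; first by rewrite addn0 !subrr normr0 mulr0.
rewrite addnS -(subrKA (u (n + k)%N)); apply: le_trans (ler_normD _ _) _.
have := uc (n + k)%N; have := dyadicS (n + k).
nra.
Qed.

Lemma dyadic_dist_le (V : normedModType R) (u : nat -> V) (c : R) n k :
  0 <= c -> (forall n, `|u n - u n.+1| <= c * dyadic n) ->
  `|u n - u (n + k)%N| <= 2 * c * dyadic n.
Proof.
move=> c0 uc; apply: le_trans (dyadic_dist _ _ uc) _.
by have := dyadic_gt0 (n + k); nra.
Qed.

Lemma dyadic_lim_dist (V : normedModType R) (u : nat -> V) (c : R) (x : V) :
  0 <= c -> (forall n, `|u n - u n.+1| <= c * dyadic n) ->
  u @ \oo --> x -> `|u 0%N - x| <= 2 * c.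
Proof.
move=> c0 uc ux; apply/ler_addgt0Pr => e e0.
have [n _ un] := cvgr_dist_le _ _ ux _ e0.
have := @dyadic_dist_le _ u c 0 n c0 uc; rewrite add0n /dyadic expr0 mulr1 => u0n.
rewrite -(subrKA (u n)); apply: le_trans (ler_normD _ _) _.
by rewrite lerD// distrC; apply: un => /=.
Qed.

Lemma dyadic_cvg (m : nat) (u : nat -> 'rV[R]_m * R^o) (c : R) :
  0 <= c -> (forall n, `|u n - u n.+1| <= c * dyadic n) ->
  exists x : 'rV[R]_m * R^o, u @ \oo --> x.
Proof.
move=> c0 uc.
have cau (W : normedModType R) (f : nat -> W) :
    (forall n, `|f n - f n.+1| <= c * dyadic n) -> cauchy (f @ \oo).
  move=> fc; apply: cauchy_exP => e e0.
  (* The [+ 1] keeps the denominator positive when [c = 0]. *)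
  have e'0 : 0 < e / (2 * c + 1) by rewrite divr_gt0//; lra.
  have [n _ /(_ n (leqnn n))] := dyadic_small e'0.
  rewrite ltr_pdivlMr; last lra; move=> nsmall.
  exists (f n); exists n => // k /= nk; rewrite -ball_normE /ball_/=.
  rewrite -(subnKC nk); apply: le_lt_trans (dyadic_dist_le _ _ c0 fc) _.
  by have := dyadic_gt0 n; nra.
have /cauchy_cvgP/cvg_ex[a ua] : cauchy ((fun n => (u n).1) @ \oo).
  apply: cau => n; apply: le_trans (uc n).
  by rewrite prod_normE le_max lexx.
have /cauchy_cvgP/cvg_ex[b ub] : cauchy ((fun n => (u n).2) @ \oo).
  apply: cau => n; apply: le_trans (uc n).
  by rewrite prod_normE le_max lexx orbT.
exists (a, b).
rewrite (_ : u = fun n => ((u n).1, (u n).2)); last by apply/funext => n; case: (u n).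
exact: (@cvg_pair _ _ _ _ (nbhs (a : 'rV[R]_m)) (nbhs (b : R^o))).
Qed.

End DyadicSequences.

(** * One measurable selection by successive approximation *)

Section MeasurableSelection.
Context {d : measure_display} {Omega : measurableType d} {R : realType} {m : nat}.
Local Notation V := ('rV[R]_m * R^o)%type.

Variable S : Omega -> set V.
Hypothesis S_closed : forall w, closed (S w).
Hypothesis S_measurable : measurable_setvalued S.

Variable q : nat -> V.
Hypothesis q_dense : forall (p : V) (e : R), 0 < e -> exists i, ball (q i) e p.

Let hits (w : Omega) (O : set V) : Prop := S w `&` O !=set0.

Variables (i0 k0 : nat).

(* The ball of radius [dyadic (k0 + n)] around [q (selection_index n w)] meets
   [S w]; the next index is the first one whose ball of half the radius still
   meets [S w] inside the current ball.  Starting from [i0] whenever possible makes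
   the resulting selections dense in [S w] when [i0] and [k0] vary. *)
Fixpoint selection_index (n : nat) (w : Omega) : nat :=
  match n with
  | 0%N => if `[< hits w (ball (q i0) (dyadic k0)) >] then i0
           else first_index (fun i => hits w (ball (q i) (dyadic k0))) 0
  | n'.+1 => first_index (fun i => hits w
       (ball (q (selection_index n' w)) (dyadic (k0 + n')) `&`
        ball (q i) (dyadic (k0 + n'.+1)))) (selection_index n' w)
  end.

Let q_hits w (O : set V) e : 0 < e -> hits w O ->
  exists i, hits w (O `&` ball (q i) e).
Proof.
by move=> e0 [p [Sp Op]]; have [i qi] := q_dense p e0; exists i, p.
Qed.

Lemma selection_index_hits n w : S w !=set0 ->
  hits w (ball (q (selection_index n w)) (dyadic (k0 + n))).
Proof.
move=> S0; elim: n => [|n IH] /=.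
  rewrite addn0; case: asboolP => // _.
  apply: (@first_indexP (fun i => hits w (ball (q i) (dyadic k0)))).
  have /(q_hits (dyadic_gt0 k0)) [i] : hits w setT.
    by case: S0 => p Sp; exists p.
  by rewrite setTI => ?; exists i.
have /first_indexP := q_hits (dyadic_gt0 (k0 + n.+1)) IH.
by move=> /(_ (selection_index n w)) [p [Sp [_ qp]]]; exists p.
Qed.

(** Two consecutive balls share a point of [S w], so their centres are no further apart than the sum
    of the radii, which is below twice the larger one. Where [S w] is empty the index does not
    change. *)
Lemma selection_index_dist n w :
  `|q (selection_index n w) - q (selection_index n.+1 w)| <=
  2 * dyadic k0 * dyadic n.
Proof.
have [S0|S0] := pselect (S w !=set0); last first.
  rewrite /= first_index_default ?subrr ?normr0.
    by have := dyadic_gt0 (R:=R) k0; have := dyadic_gt0 (R:=R) n; nra.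
  by move=> [i [p [Sp _]]]; apply: S0; exists p.
have /first_indexP := q_hits (dyadic_gt0 (k0 + n.+1)) (selection_index_hits n S0).
move=> /(_ (selection_index n w)) [p [Sp []]] /=.
rewrite -!ball_normE /ball_/= => p1 p2.
rewrite -(subrKA p); apply: le_trans (ler_normD _ _) _.
rewrite -[in X in _ + X]normrN opprB; move: p1 p2.
have := dyadicS (R:=R) (k0 + n); rewrite -addnS.
have -> : 2 * dyadic k0 * dyadic n = 2 * dyadic (k0 + n) :> R.
  by rewrite /dyadic exprD mulrA.
have : 0 < dyadic (k0 + n.+1) :> R := dyadic_gt0 _.
lra.
Qed.

Lemma selection_index_measurable n i : measurable [set w | selection_index n w = i].
Proof.
have mhits O : open O -> measurable [set w | hits w O] by exact: S_measurable.
elim: n i => [|n IH] i /=.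
  rewrite (_ : [set _ | _] =
      ([set w | hits w (ball (q i0) (dyadic k0))] `&` [set w | i0 = i]) `|`
      (~` [set w | hits w (ball (q i0) (dyadic k0))] `&`
       [set w | first_index (fun i => hits w (ball (q i) (dyadic k0))) 0 = i])).
    apply: measurableU; apply: measurableI => //.
    - by apply: mhits; exact: ball_open.
    - exact: measurable_set_Prop.
    - by apply: measurableC; apply: mhits; exact: ball_open.
    - apply: (@measurable_first_index _ _
          (fun w i => hits w (ball (q i) (dyadic k0)))) => j.
      by apply: mhits; exact: ball_open.
  apply/seteqP; split => w /=; case: asboolP => h /=; first by left.
  - by right.
  - by case=> -[].
  - by case=> -[].
rewrite (_ : [set _ | _] = \bigcup_j ([set w | selection_index n w = j] `&`
   [set w | first_index (fun i => hits w (ball (q j) (dyadic (k0 + n)) `&`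
        ball (q i) (dyadic (k0 + n.+1)))) j = i])).
  apply: bigcupT_measurable => j; apply: measurableI => //.
  apply: (@measurable_first_index _ _ (fun w i => hits w
      (ball (q j) (dyadic (k0 + n)) `&` ball (q i) (dyadic (k0 + n.+1))))) => k.
  by apply: mhits; apply: openI; exact: ball_open.
apply/seteqP; split => w /=; first by move=> ?; exists (selection_index n w).
by move=> [j _ [-> ]].
Qed.

(** The centres converge and come arbitrarily close to [S w], so closedness puts their limit in it.
    If the first ball meets [S w], the search starts at [q i0] and moves by at most [4 * dyadic k0];
    the distance from [p] to [q i0] adds one more, whence the 5. *)
Lemma measurable_selection_near : exists x : Omega -> V,
  [/\ forall w, S w !=set0 -> S w (x w),
      forall c : V -> R, continuous c -> measurable_fun setT (c \o x) &
      forall w p, S w p -> ball (q i0) (dyadic k0) p ->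
        `|p - x w| <= 5 * dyadic k0].
Proof.
have c0 : 0 <= 2 * dyadic k0 :> R by rewrite mulr_ge0// ltW// dyadic_gt0.
have ucvg w : exists x : V, q (selection_index n w) @[n --> \oo] --> x.
  exact: (dyadic_cvg (u := fun n => q (selection_index n w)) c0
    (fun n => selection_index_dist n w)).
have [x xlim] := choice ucvg.
exists x; split.
- move=> w S0; apply: (S_closed (w := w)) => B /nbhs_ballP[e /= e0 eB].
  have e20 : 0 < e / 2 by rewrite divr_gt0.
  have [n1 _ h1] := dyadic_small e20.
  have [n2 _ h2] := cvgr_dist_le _ _ (xlim w) _ e20.
  pose n := maxn n1 n2.
  have [p [Sp qp]] := selection_index_hits n S0.
  exists p; split => //; apply: eB.
  rewrite -ball_normE /ball_/= in qp *.
  have := h2 n (leq_maxr _ _); have := h1 (k0 + n)%N.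
  rewrite /= (leq_trans (leq_maxl _ _) (leq_addl k0 _)) => /(_ isT) a b.
  rewrite -(subrKA (q (selection_index n w))); apply: le_lt_trans (ler_normD _ _) _.
  by move: a b qp; lra.
(* Each approximant takes only the countably many values [q i], on measurable level sets;
   measurability passes to the pointwise limit. *)
- move=> c cc; apply: (@measurable_fun_cvg _ _ _ _
    (fun n w => c (q (selection_index n w)))) => [n|w _]; last first.
    exact: (cvg_comp _ _ (xlim w) (cc _)).
  move=> _ B mB; rewrite setTI.
  rewrite (_ : _ @^-1` _ = \bigcup_(i in [set i | B (c (q i))])
      [set w | selection_index n w = i]).
    by apply: bigcup_measurable => i _; exact: selection_index_measurable.
  apply/seteqP; split => w /=; first by move=> ?; exists (selection_index n w).
  by move=> [i Bi ->].
- move=> w p Sp qp.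
  have i0E : selection_index 0 w = i0.
    by rewrite /=; case: asboolP => // -[]; exists p.
  have := dyadic_lim_dist c0 (fun n => selection_index_dist n w) (xlim w).
  rewrite i0E => qx; rewrite -(subrKA (q i0)); apply: le_trans (ler_normD _ _) _.
  move: qp; rewrite -ball_normE /ball_/= -normrN opprB.
  by move: qx; lra.
Qed.

End MeasurableSelection.

Definition measurable_vector d (Omega : measurableType d) (R : realType) (m : nat)
    (x : Omega -> 'rV[R]_m) : Prop :=
  forall j, measurable_fun setT (fun w => x w 0 j).

(** * Castaing representations *)

Section Castaing.
Context {R : realType} {m : nat}.
Local Notation V := ('rV[R]_m * R^o)%type.

Lemma exists_dense_sequence : exists q : nat -> V,
  forall (p : V) (e : R), 0 < e -> exists i, ball (q i) e p.
Proof.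
pose q i : V := if unpickle i is Some r then
  (map_mx ratr (r : 'rV[rat]_m * rat).1, ratr r.2) else 0.
exists q => p e e0.
have rat_near (a : R) : exists r : rat, `|ratr r - a| < e.
  have [r] := @rat_in_itvoo R (a - e) (a + e) ltac:(lra).
  by rewrite in_itv/= => /andP[? ?]; exists r; rewrite ltr_norml; lra.
have [f fP] := choice (fun j => rat_near (p.1 0 j)).
have [g gP] := rat_near p.2.
exists (pickle (\row_j f j, g)); rewrite /q pickleK /=.
split => /=; last by [].
by split => // i j; rewrite !mxE ord1; exact: fP.
Qed.

(** Letting the initial centre and radius run over all pairs gives density: a radius below [e / 5]
    absorbs the factor 5 of [measurable_selection_near]. *)
Lemma castaing_representation d (Omega : measurableType d) (S : Omega -> set V) :
  (forall w, closed (S w)) -> measurable_setvalued S ->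
  exists y : nat -> Omega -> V,
  [/\ forall i w, S w !=set0 -> S w (y i w),
      forall i, measurable_vector (fun w => (y i w).1),
      forall i, measurable_fun setT (fun w => (y i w).2 : R) &
      forall w p e, S w p -> 0 < e -> exists i, `|p - y i w| <= e].
Proof.
move=> cS mS; have [q q_dense] := exists_dense_sequence.
have [y yP] := choice (fun ik : nat * nat =>
  measurable_selection_near cS mS q_dense ik.1 ik.2).
(* Naturals that code no pair just repeat the selection of the pair [(0, 0)]. *)
exists (fun n => y (odflt (0, 0)%N (unpickle n))); split.
- by move=> i w; have [+ _ _] := yP (odflt (0, 0)%N (unpickle i)); exact.
- move=> i j; have [_ ym _] := yP (odflt (0, 0)%N (unpickle i)).
  apply: (ym (fun p => p.1 0 j)) => p.
  apply: (@continuous_comp _ _ _ (fst : V -> 'rV[R]_m) (fun M => M 0 j)).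
    exact: cvg_fst.
  exact: coord_continuous.
- move=> i; have [_ ym _] := yP (odflt (0, 0)%N (unpickle i)).
  by apply: (ym snd) => p; exact: cvg_snd.
- move=> w p e Sp e0; have e50 : 0 < e / 5 by rewrite divr_gt0.
  have [k _ /(_ k (leqnn k)) ke] := dyadic_small e50.
  have [i qi] := q_dense p _ (dyadic_gt0 k).
  exists (pickle (i, k)); rewrite pickleK /=.
  have [_ _ /(_ w p Sp qi)] := yP (i, k); move: ke => /=; lra.
Qed.

End Castaing.

(** * Measurability of a normal integrand and of its conjugate along random vectors *)

Section NormalIntegrand.
Context {d : measure_display} {Omega : measurableType d} {R : realType} {m : nat}.
Local Notation V := ('rV[R]_m * R^o)%type.
Variable h : 'rV[R]_m -> Omega -> \bar R.
Hypothesis h_normal : normal_integrand h.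

Lemma coord_le_norm (a : 'rV[R]_m) j : `|a 0 j| <= `|a|.
Proof.
have -> : `|a| = \big[Num.max/0]_ij `|a ij.1 ij.2| by exact: mx_normrE.
exact: (le_bigmax _ (fun ij : 'I_1 * 'I_m => `|a ij.1 ij.2|) (0, j)).
Qed.

Lemma dotBl (a b u : 'rV[R]_m) : dot (a - b) u = dot a u - dot b u.
Proof. by rewrite /dot -sumrB; apply: eq_bigr => j _; rewrite !mxE mulrBl. Qed.

Lemma dot_le_norm (a u : 'rV[R]_m) : dot a u <= `|a| * \sum_j `|u 0 j|.
Proof.
rewrite /dot mulr_sumr; apply: ler_sum => j _.
by apply: le_trans (ler_norm _) _; rewrite normrM ler_wpM2r// coord_le_norm.
Qed.

Lemma measurable_dot (x v : Omega -> 'rV[R]_m) :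
  measurable_vector x -> measurable_vector v ->
  measurable_fun setT (fun w => dot (x w) (v w)).
Proof.
by move=> mx mv; apply: measurable_sum => j; apply: measurable_funM.
Qed.

(** The value exceeds [a] exactly when [(x w, a)] lies outside the epigraph. As the epigraph is
    closed, membership has a countable test: for every [k], some ball of radius [dyadic k] about a
    [q i] contains the point and meets the epigraph. *)
Lemma measurable_integrand (x : Omega -> 'rV[R]_m) :
  measurable_vector x -> measurable_fun setT (fun w => h (x w) w).
Proof.
move=> mx; have [h_closed h_meas] := h_normal.
have [q q_dense] := @exists_dense_sequence R m.
apply: (measurability (@ErealGenOInfty.G R)).
  exact: ErealGenOInfty.measurableE.
move=> _ [_ [a ->] <-]; rewrite setTI.
rewrite (_ : _ @^-1` _ = ~` \bigcap_k \bigcup_i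
   ([set w | ball (q i) (dyadic k) ((x w, a) : V)] `&`
    [set w | epigraph h w `&` ball (q i) (dyadic k) !=set0])).
  apply: measurableC; apply: bigcapT_measurable => k.
  apply: bigcupT_measurable => i; apply: measurableI; last first.
    by apply: h_meas; exact: ball_open.
  rewrite (_ : [set _ | _] =
      \bigcap_(j in [set: 'I_m]) [set w | ball ((q i).1 0 j) (dyadic k) (x w 0 j)]
      `&` [set w | ball (q i).2 (dyadic k) (a : R^o)]).
    apply: measurableI.
      apply: fin_bigcap_measurable; first exact: finite_finset.
      move=> j _; rewrite -[X in measurable X]setTI; apply: mx => //.
      by apply: open_measurable; exact: ball_open.
    exact: measurable_set_Prop.
  apply/seteqP; split => w /=.
    by move=> [[_ b1] b2]; split => // j _; exact: b1.
  move=> [b1 b2]; split => //; split; first exact: dyadic_gt0.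
  by move=> i' j; rewrite ord1; exact: b1.
apply/seteqP; split => w /=; rewrite in_itv/= andbT.
  move=> ah hw; move: ah; rewrite ltNge => /negP; apply.
  apply: (h_closed w ((x w, a) : V)) => B /nbhs_ballP[e /= e0 eB].
  have e20 : 0 < e / 2 by rewrite divr_gt0.
  have [k _ /(_ k (leqnn k)) ke] := dyadic_small e20.
  have [i _ [qx [p [Sp qp]]]] := hw k Logic.I.
  exists p; split => //; apply: eB; apply: le_ball (ball_triangle (ball_sym qx) qp).
  by move: ke => /=; lra.
move=> nh; rewrite ltNge; apply/negP => ha; apply: nh => k _.
have [i qi] := q_dense ((x w, a) : V) _ (dyadic_gt0 k).
by exists i => //; split => //; exists (x w, a).
Qed.

Lemma conj_integrand_ge (u xi : 'rV[R]_m) w :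
  ((dot xi u)%:E - h xi w <= conj_integrand h u w)%E.
Proof. by apply: ereal_sup_ubound; exists xi. Qed.

(** On the epigraph the maximized function is real-valued and continuous, so the supremum can later
    be restricted to a dense sequence, which is not possible with [h] itself. *)
Lemma conj_integrand_epigraph (u : 'rV[R]_m) w : conj_integrand h u w =
  ereal_sup [set (dot p.1 u - p.2)%:E | p in epigraph h w].
Proof.
apply/eqP; rewrite eq_le; apply/andP; split.
  apply: ge_ereal_sup => _ [xi _ <-].
  case E : (h xi w) => [r| |].
  - by apply: ereal_sup_ubound; exists (xi, r) => //=; rewrite /epigraph/= E.
  - by rewrite addeNy leNye.
  (* Where [h] is [-oo] the epigraph contains a whole vertical line; height [dot xi u - A] on it
     gives the value [A]. *)
  - rewrite /= addey//; rewrite leye_eq; apply/eqP/eqyP => A A0.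
    apply: le_trans (ereal_sup_ubound (x := (dot xi u - (dot xi u - A))%:E) _).
      by rewrite lee_fin; lra.
    by exists (xi, dot xi u - A) => //=; rewrite /epigraph/= E leNye.
apply: ge_ereal_sup => _ [p Sp <-].
apply: le_trans (conj_integrand_ge u p.1 w).
by rewrite EFinB; apply: leeB.
Qed.

Lemma conj_integrand_dense (y : nat -> V) (u : 'rV[R]_m) w :
  (forall i, epigraph h w (y i)) ->
  (forall p e, epigraph h w p -> 0 < e -> exists i, `|p - y i| <= e) ->
  conj_integrand h u w = ereal_sup [set (dot (y i).1 u - (y i).2)%:E | i in setT].
Proof.
move=> yS yd; rewrite conj_integrand_epigraph; apply/eqP; rewrite eq_le.
apply/andP; split; last first.
  by apply: ge_ereal_sup => _ [i _ <-]; apply: ereal_sup_ubound; exists (y i).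
apply: ge_ereal_sup => _ [p Sp <-].
apply/lee_addgt0Pr => e e0.
(* A Lipschitz constant of the maximized function for the max norm: the sum accounts for the vector
   component, the 1 for the height. *)
pose K := \sum_j `|u 0 j| + 1.
have K0 : 0 < K by rewrite ltr_wpDl// sumr_ge0.
have [i iP] := yd p (e / K) Sp (divr_gt0 e0 K0).
apply: (@le_trans _ _ ((dot (y i).1 u - (y i).2)%:E + e%:E)%E); last first.
  by rewrite leeD2r//; apply: ereal_sup_ubound; exists i.
rewrite -EFinD lee_fin.
move: iP; rewrite ler_pdivlMr// prod_normE.
have := dot_le_norm (p.1 - (y i).1) u; rewrite dotBl.
set b := \sum_j _ in K K0 *; have b0 : 0 <= b by rewrite sumr_ge0.
have n1 : `|p.1 - (y i).1| <= Num.max `|(p - y i).1| `|(p - y i).2|.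
  by rewrite le_max lexx.
have n2 : `|p.2 - (y i).2| <= Num.max `|(p - y i).1| `|(p - y i).2|.
  by rewrite le_max lexx orbT.
have := ler_norm ((y i).2 - p.2); rewrite distrC.
move: (Num.max _ _) n1 n2 => M; rewrite /K; set n1 := `|_|; set n2 := `|_|.
have : 0 <= n1 by rewrite /n1.
nra.
Qed.

Lemma measurable_conj_integrand (v : Omega -> 'rV[R]_m) :
  measurable_vector v -> measurable_fun setT (fun w => conj_integrand h (v w) w).
Proof.
move=> mv; have [h_closed h_meas] := h_normal.
have [y [yS my1 my2 yd]] := castaing_representation h_closed h_meas.
have mD : measurable [set w | epigraph h w !=set0].
  by have := h_meas setT openT; under eq_set do rewrite setIT.
(* The supremum over all selections. It is meaningful only where the epigraph is nonempty; elsewhere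
   the conjugate is [-oo], hence the case distinction. *)
pose g w := esups (fun i => (dot (y i w).1 (v w) - (y i w).2)%:E) 0.
have -> : (fun w => conj_integrand h (v w) w) =
    (fun w => if w \in [set w | epigraph h w !=set0] then g w else -oo%E).
  apply/funext => w; case: ifPn; rewrite ?(inE, notin_setE)/= => S0.
    rewrite (@conj_integrand_dense (y ^~ w))//; last by move=> p e; exact: yd.
      by rewrite /g /esups /sdrop; congr ereal_sup; apply/seteqP; split => _ /=
        [i _ <-]; exists i.
    by move=> i; exact: yS.
  rewrite conj_integrand_epigraph (_ : epigraph h w = set0) ?image_set0 ?ereal_sup0//.
  by apply/seteqP; split => // p Sp; apply: S0; exists p.
apply: measurable_fun_ifT => //.
  by apply: (measurable_fun_bool true); rewrite setTI preimage_mem_true.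
apply: measurable_fun_esups => i.
apply/measurable_EFinP; apply: measurable_funB => //.
by apply: measurable_dot.
Qed.

End NormalIntegrand.

(** * Sums of adapted terms *)

Section AdaptedSums.
Context {d : measure_display} {Omega : measurableType d} {R : realType}.
Variable mu : {measure set Omega -> \bar R}.

Lemma integrable_funeposneg (D : set Omega) (f : Omega -> \bar R) :
  measurable D -> measurable_fun D f -> mu.-integrable D f^\+%E ->
  (\int[mu]_(w in D) f^\- w < +oo)%E -> mu.-integrable D f.
Proof.
move=> mD mf fp fn; rewrite (funeposneg f); apply: integrableB => //.
apply/integrableP; split; first exact: measurable_funeneg.
by under eq_integral do rewrite gee0_abs//.
Qed.

(** On each [C k], equality of the integrals bounds that of the negative part of [Y] by the
    integrals over [D] of the positive part of [Y] and the negative part of [U]. Monotone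
    convergence carries this uniform bound to [D]. *)
Lemma integrable_exhaustion (D : set Omega) (C : nat -> set Omega) (Y U : Omega -> R) :
  measurable D -> (forall k, measurable (C k)) ->
  nondecreasing_seq C -> \bigcup_k C k = D ->
  measurable_fun D Y -> mu.-integrable D (EFin \o U) ->
  mu.-integrable D (EFin \o Y)^\+%E ->
  (forall k, mu.-integrable (C k) (EFin \o Y)) ->
  (forall k, \int[mu]_(w in C k) (Y w)%:E = \int[mu]_(w in C k) (U w)%:E)%E ->
  mu.-integrable D (EFin \o Y) /\
  (\int[mu]_(w in D) (Y w)%:E = \int[mu]_(w in D) (U w)%:E)%E.
Proof.
move=> mD mC ndC CD mY iU iYp iYC YU.
have CsubD k : C k `<=` D by rewrite -CD; exact: bigcup_sup.
have mEY : measurable_fun D (EFin \o Y) by exact/measurable_EFinP.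
have iY : mu.-integrable D (EFin \o Y).
  apply: integrable_funeposneg => //.
  apply: (@le_lt_trans _ _ (\int[mu]_(w in D) (EFin \o Y)^\+ w +
      \int[mu]_(w in D) (EFin \o U)^\- w)%E); last first.
    rewrite lte_add_pinfty//; first exact: integrable_lty.
    by rewrite ltey_eq integrable_neg_fin_num.
  rewrite -CD; apply: (cvge_le _ (ge0_nondecreasing_set_cvg_integral ndC mC _ _)) => //.
  - apply: nearW => k; rewrite CD.
    have iUC := integrableS mD (mC k) (CsubD k) iU.
    have := YU k; rewrite integralE [RHS]integralE.
    have := ge0_subset_integral mu (mC k) mD (measurable_int _ iYp)
      (fun w _ => funepos_ge0 _ w) (CsubD k).
    have := ge0_subset_integral mu (mC k) mD
      (measurable_funeneg (measurable_int _ iU))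
      (fun w _ => funeneg_ge0 _ w) (CsubD k).
    have := integral_ge0 mu (D := C k) (f := (EFin \o U)^\+%E)
      (fun w _ => funepos_ge0 _ w).
    move: (integrable_neg_fin_num (mC k) (iYC k)) (integrable_pos_fin_num (mC k) (iYC k))
      (integrable_neg_fin_num (mC k) iUC) (integrable_pos_fin_num (mC k) iUC)
      (integrable_neg_fin_num mD iU) (integrable_fin_num mD iYp).
    do 6 move=> /fineK <-.
    rewrite -!EFinB -EFinD !lee_fin => ? ? ? [?]; lra.
  - by move=> k; apply: measurable_funeneg; apply: measurable_funS mEY.
split => //.
(* The positive and negative parts of [Z] have equal integrals on every [C k]; monotone convergence
   for each part gives the same on [D]. *)
pose Z := ((EFin \o Y) \- (EFin \o U))%E.
have iZ : mu.-integrable D Z by exact: integrableB.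
have ZC k : (\int[mu]_(w in C k) Z^\+ w = \int[mu]_(w in C k) Z^\- w)%E.
  have iUC := integrableS mD (mC k) (CsubD k) iU.
  have iZC := integrableS mD (mC k) (CsubD k) iZ.
  have : (\int[mu]_(w in C k) Z w = 0)%E.
    rewrite /Z integralB//= YU subee//.
    exact: (integrable_fin_num (mC k) iUC).
  rewrite integralE.
  move: (integrable_neg_fin_num (mC k) iZC) (integrable_pos_fin_num (mC k) iZC).
  by do 2 move=> /fineK <-; rewrite -EFinB => -[/eqP]; rewrite subr_eq0 => /eqP ->.
have ZD : (\int[mu]_(w in D) Z^\+ w = \int[mu]_(w in D) Z^\- w)%E.
  rewrite -CD.
  have h1 := @ge0_nondecreasing_set_cvg_integral _ _ _ C Z^\+%E mu ndC mC
    (fun k => measurable_funS mD (CsubD k) (measurable_funepos (measurable_int _ iZ)))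
    (fun k w _ => funepos_ge0 _ w).
  have h2 := @ge0_nondecreasing_set_cvg_integral _ _ _ C Z^\-%E mu ndC mC
    (fun k => measurable_funS mD (CsubD k) (measurable_funeneg (measurable_int _ iZ)))
    (fun k w _ => funeneg_ge0 _ w).
  move: h1; rewrite (funext ZC) => h1; exact: (cvg_unique _ h1 h2).
have : (\int[mu]_(w in D) Z w = 0)%E.
  by rewrite integralE ZD subee// integrable_neg_fin_num.
rewrite integralB//=.
move: (integrable_fin_num mD iU) (integrable_fin_num mD iY) => /=.
by do 2 move=> /fineK <-; rewrite -EFinB => -[/eqP]; rewrite subr_eq0 => /eqP ->.
Qed.

Lemma sigma_algebra_setI (G : set (set Omega)) (A B : set Omega) :
  sigma_algebra setT G -> G A -> G B -> G (A `&` B).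
Proof.
move=> [G0 GC GU] GA GB.
rewrite -[A `&` B]setCK setCI -setTD; apply: (GC).
rewrite -bigcup2E; apply: GU => -[|[|n]] //=; rewrite -setTD; exact: GC.
Qed.

(* Truncating to [{|X j| <= k}], which lies in every later sigma-algebra, makes
   the earliest term integrable with zero integral; the remaining terms are
   handled by induction, so no conditional expectation is needed. *)
Lemma integral_adapted_sum (J : eqType) (r : rel J) (G : J -> set (set Omega))
    (X W : J -> Omega -> R) (s : seq J) :
  (forall j, sigma_algebra setT (G j)) ->
  (forall j, G j `<=` measurable) ->
  (forall i j, r i j -> G i `<=` G j) ->
  (forall j B, measurable B -> G j (X j @^-1` B)) ->
  (forall j, measurable_fun setT (W j)) ->
  (forall j C k, G j C -> (forall w, C w -> `|X j w| <= k) ->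
     mu.-integrable C (fun w => (X j w * W j w)%:E) /\
     (\int[mu]_(w in C) (X j w * W j w)%:E)%E = 0%E) ->
  pairwise r s ->
  forall (D : set Omega) (U : Omega -> R),
  measurable D -> (forall j, j \in s -> G j D) ->
  mu.-integrable D (EFin \o U) ->
  let Y w := U w + \sum_(j <- s) X j w * W j w in
  mu.-integrable D (EFin \o Y)^\+%E ->
  mu.-integrable D (EFin \o Y) /\
  (\int[mu]_(w in D) (Y w)%:E = \int[mu]_(w in D) (U w)%:E)%E.
Proof.
move=> Gs Gm rG XG mW XW.
have mX j : measurable_fun setT (X j).
  by move=> _ B mB; rewrite setTI; apply: Gm; exact: XG.
elim: s => [|j s IH] /=.
  move=> _ D U mD _ iU; under eq_fun do rewrite big_nil addr0.
  by move=> _; split => //; under eq_integral do rewrite big_nil addr0.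
move=> /andP[rjs rs] D U mD GD iU iYp.
pose C k := D `&` [set w | `|X j w| <= k%:R].
have GjC k : G j (C k).
  apply: sigma_algebra_setI => //; first by apply: GD; rewrite mem_head.
  rewrite (_ : [set w | _] = X j @^-1` [set x | `|x| <= k%:R]) //.
  apply: XG; rewrite (_ : [set _ | _] = `[- k%:R, k%:R]%classic) //.
  by apply/seteqP; split => x /=; rewrite in_itv/= ler_norml.
have mC k : measurable (C k) by exact: Gm (GjC k).
have CsubD k : C k `<=` D by move=> w [].
pose Y w := U w + \sum_(j <- j :: s) X j w * W j w.
have mY : measurable_fun D Y.
  apply: measurable_funD; first exact/measurable_EFinP/(measurable_int _ iU).
  by apply: measurable_sum => i; apply: measurable_funTS; exact: measurable_funM.
have Ck k : mu.-integrable (C k) (EFin \o Y) /\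
    (\int[mu]_(w in C k) (Y w)%:E = \int[mu]_(w in C k) (U w)%:E)%E.
  have [iXW XW0] := XW j (C k) k%:R (GjC k) (fun w => @proj2 _ _).
  have iUC := integrableS mD (mC k) (CsubD k) iU.
  have YE : (fun w => U w + X j w * W j w + \sum_(i <- s) X i w * W i w) = Y.
    by apply/funext => w; rewrite /Y big_cons addrA.
  (* The truncated term, now integrable, is absorbed into the base term [U] of the induction
     hypothesis. *)
  have := IH rs (C k) (fun w => U w + X j w * W j w) (mC k).
  rewrite YE => -[].
  - by move=> i is_; apply: rG (GjC k); exact: (allP rjs).
  - by have := integrableD (mC k) iUC iXW; apply: eq_integrable.
  - exact: integrableS (CsubD k) iYp.
  - move=> iY ->; split => //; under eq_integral do rewrite EFinD.
    by rewrite integralD// XW0 adde0.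
apply: (integrable_exhaustion (C := C)) => // [k l kl||k|k].
- apply/subsetPset => w [Dw /= Xk]; split => //=.
  by apply: le_trans Xk _; rewrite ler_nat.
- apply/seteqP; split => w /=; first by move=> [k _ []].
  move=> Dw; exists (Num.trunc `|X j w|).+1 => //; split => //=.
  by apply/ltW; rewrite truncnS_gt.
- by case: (Ck k).
- by case: (Ck k).
Qed.

End AdaptedSums.

(** * Expectations and Lp spaces *)

Section Expectation.
Context {d : measure_display} {Omega : measurableType d} {R : realType}.
Variable P : probability Omega R.
Implicit Types f g : Omega -> \bar R.

(** Positive and negative parts are compared separately, so the result also serves for integrands
    whose negative part is not yet controlled. *)
Lemma ae_le_integral f g : measurable_fun setT f -> measurable_fun setT g ->
  {ae P, forall w, (f w <= g w)%E} -> (\int[P]_w f w <= \int[P]_w g w)%E.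
Proof.
move=> mf mg fg; rewrite integralE [leRHS]integralE; apply: leeB.
  apply: ae_ge0_le_integral => //; [exact: measurable_funepos..|].
  apply: filterS fg => w fgw _; rewrite !funeposE.
  by rewrite ge_max !le_max fgw lexx orbT.
apply: ae_ge0_le_integral => //; [exact: measurable_funeneg..|].
apply: filterS fg => w fgw _; rewrite !funenegE.
by rewrite ge_max !le_max leeN2 fgw lexx orbT.
Qed.

Lemma ae_le_integrable f g : measurable_fun setT f -> P.-integrable setT g ->
  {ae P, forall w, (`|f w| <= `|g w|)%E} -> P.-integrable setT f.
Proof.
move=> mf /integrableP[mg ig] fg; apply/integrableP; split => //.
apply: le_lt_trans ig; apply: ae_ge0_le_integral => //.
- exact: measurableT_comp.
- exact: measurableT_comp.
- by apply: filterS fg.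
Qed.

Lemma ae_sandwich_integrable f g1 g2 : measurable_fun setT f ->
  P.-integrable setT g1 -> P.-integrable setT g2 ->
  {ae P, forall w, (g1 w <= f w <= g2 w)%E} -> P.-integrable setT f.
Proof.
move=> mf i1 i2 gfg.
have i12 : P.-integrable setT (fun w => `|g1 w| + `|g2 w|)%E.
  by apply: integrableD => //; exact: integrable_abse.
apply: ae_le_integrable mf i12 _; apply: filterS gfg => w /andP[l u].
rewrite [leRHS]gee0_abs ?adde_ge0//.
have [f0|f0] := leP 0%E (f w).
  by rewrite gee0_abs//; apply: (le_trans u); rewrite (le_trans (lee_abs _))// leeDr.
rewrite lte0_abs//; apply: (@le_trans _ _ (- g1 w)%E); first by rewrite leeN2.
by rewrite (le_trans (lee_abs _))// abseN leeDl.
Qed.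

Lemma funepos_integrable_minorant f g : measurable_fun setT f ->
  P.-integrable setT f^\+%E -> P.-integrable setT g ->
  {ae P, forall w, (g w <= f w)%E} -> P.-integrable setT f.
Proof.
move=> mf ifp ig gf; apply: (ae_sandwich_integrable mf ig ifp).
by apply: filterS gf => w ->; rewrite funeposE le_max lexx.
Qed.

(** Turns equality in an integrated Fenchel inequality into almost sure equality: a nonnegative
    function with zero integral vanishes almost everywhere. *)
Lemma ae_eq_of_le_integral (f g : Omega -> \bar R) :
  P.-integrable setT f -> P.-integrable setT g ->
  {ae P, forall w, (f w <= g w)%E} -> (\int[P]_w f w = \int[P]_w g w)%E ->
  {ae P, forall w, f w = g w}.
Proof.
move=> fi gi fg fgE; pose u w := (g w - f w)%E.
have ui : P.-integrable setT u by exact: integrableB.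
have mu := measurable_int _ ui.
have : (\int[P]_w `|u w| = 0)%E.
  rewrite (ae_eq_integral u) => //.
  - by rewrite integralB// fgE subee// integrable_fin_num.
  - exact: measurableT_comp.
  - apply: filterS2 fg (integrable_ae measurableT fi) => w fgw ffin _.
    by rewrite gee0_abs// sube_ge0// ffin.
move=> /(ae_eq_integral_abs _ measurableT mu); apply: filterS3
  (integrable_ae measurableT fi) (integrable_ae measurableT gi).
move=> w /(_ Logic.I) + /(_ Logic.I) + /(_ Logic.I); rewrite /u.
case: (f w) => // a _; case: (g w) => // b _ /=.
by move=> [/eqP]; rewrite subr_eq0 => /eqP ->.
Qed.

Lemma Ex_integrable f : P.-integrable setT f -> Ex P f = (\int[P]_w f w)%E.
Proof.
move=> fi; rewrite /Ex asboolT//; exact: integrable_funepos.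
Qed.

Lemma Ex_lty f : (Ex P f < +oo)%E -> P.-integrable setT f^\+%E.
Proof. by rewrite /Ex; case: asboolP => //; rewrite ltxx. Qed.

(** By the convention in [Ex], the upper bound makes the positive part integrable; the lower bound
    then excludes an infinite integral of the negative part. *)
Lemma integrable_Ex_lt_gt f : measurable_fun setT f ->
  (-oo < Ex P f)%E -> (Ex P f < +oo)%E -> P.-integrable setT f.
Proof.
move=> mf Egt Elt; have ifp := Ex_lty Elt.
apply: integrable_funeposneg => //.
move: Egt; rewrite /Ex asboolT// (integralE _ _ f).
have /fineK <- := integrable_fin_num measurableT ifp.
by case: (\int[P]_x f^\- x)%E => [r _|//|_]; rewrite ?ltry.
Qed.

Lemma LfunyP (f : Omega -> R) : f \in Lfun P +oo%E <->
  measurable_fun setT f /\ exists M : R, {ae P, forall w, `|f w| <= M}.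
Proof.
(* Positive total mass selects the essential supremum in the definition of the norm. *)
have P0 : (0 < P setT)%E by rewrite probability_setT lte01.
split.
  move=> /andP[]; rewrite !inE/= => mf; rewrite /finite_norm unlock P0 => fin.
  split => //; have fsup := ess_sup_ge P (abse \o (EFin \o f)).
  have fE0 : (0 <= ess_sup P (abse \o (EFin \o f)))%E.
    by apply: ess_sup_gee => //; apply: nearW => w /=; rewrite lee_fin.
  exists (fine (ess_sup P (abse \o (EFin \o f)))).
  apply: filterS fsup => w /=.
  by rewrite -[X in (_ <= X)%E -> _]fineK ?ge0_fin_numE// lee_fin.
move=> [mf [M fM]]; apply/andP; rewrite !inE/=; split => //.
rewrite /finite_norm unlock P0; apply: (@le_lt_trans _ _ M%:E); last exact: ltry.
by apply/ess_supP; apply: filterS fM => w /=; rewrite lee_fin.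
Qed.

End Expectation.

(** * Bounded and integrable random vectors *)

Section Lp_vectors.
Context {d : measure_display} {Omega : measurableType d} {R : realType} {m : nat}.
Variable P : probability Omega R.
Implicit Types z v : Omega -> 'rV[R]_m.

Lemma Lp_measurable (p : \bar R) z : Lp P p m z -> measurable_vector z.
Proof. by move=> zp j; have /sub_Lfun_mfun := zp j; rewrite inE. Qed.

Lemma LpyP z : Lp P +oo%E m z <->
  measurable_vector z /\ exists M : R, {ae P, forall w, forall j, `|z w 0 j| <= M}.
Proof.
split=> [zp|[mz [M zM]] j]; last first.
  apply/LfunyP; split; first exact: mz.
  by exists M; apply: filterS zM => w; exact.
split; first exact: Lp_measurable zp.
have [M MP] := choice (fun j => proj2 (iffLR (LfunyP P _) (zp j))).
exists (\sum_j `|M j|).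
have /filter_forall : forall j, {ae P, forall w, `|z w 0 j| <= M j} by exact: MP.
apply: filterS => w zM j; apply: le_trans (zM j) _.
rewrite (bigD1 j)//=; apply: le_trans (ler_norm _) _.
by rewrite lerDl sumr_ge0.
Qed.

Lemma integrable_dot z v : Lp P +oo%E m z -> Lp P 1%E m v ->
  P.-integrable setT (fun w => (dot (z w) (v w))%:E).
Proof.
move=> /LpyP[mz [M zM]] v1.
have mv := Lp_measurable v1.
rewrite (_ : (fun w => _) = fun w => (\sum_j (z w 0 j * v w 0 j)%:E)%E); last first.
  by apply/funext => w; rewrite sumEFin.
apply: integrable_sum => // j _.
have iv : P.-integrable setT (EFin \o (fun w => v w 0 j)) by exact/Lfun1_integrable/v1.
apply: (@ae_le_integrable _ _ _ _ _ (fun w => M%:E * (v w 0 j)%:E)%E).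
- by apply/measurable_EFinP; exact: measurable_funM.
- exact: integrableZl.
- apply: filterS zM => w zM; rewrite -EFinM !abse_EFin lee_fin !normrM.
  by rewrite ler_wpM2r//; apply: le_trans (zM j) (ler_norm _).
Qed.

Lemma Edot_integral z v : Lp P +oo%E m z -> Lp P 1%E m v ->
  Edot P z v = (\int[P]_w (dot (z w) (v w))%:E)%E.
Proof. by move=> zy v1; rewrite /Edot Ex_integrable//; exact: integrable_dot. Qed.

Lemma Edot_fin_num z v : Lp P +oo%E m z -> Lp P 1%E m v ->
  Edot P z v \is a fin_num.
Proof.
move=> zy v1; rewrite Edot_integral//; apply: integrable_fin_num => //.
exact: integrable_dot.
Qed.

End Lp_vectors.

(** * Interchange of supremum and expectation *)

Section Interchange.
Context {d : measure_display} {Omega : measurableType d} {R : realType} {m : nat}.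
Variables (P : probability Omega R) (h : 'rV[R]_m -> Omega -> \bar R).
Hypothesis h_normal : normal_integrand h.
Hypothesis h_proper : proper_on_Linfty P h.
Variable v : Omega -> 'rV[R]_m.
Hypothesis v_L1 : Lp P 1%E m v.

Let V := ('rV[R]_m * R^o)%type.

(** The height is merely measurable: integrability of the gain comes later, from properness and an
    integrable lower bound. *)
Definition bounded_selection (p : Omega -> V) : Prop :=
  [/\ Lp P +oo%E m (fun w => (p w).1), measurable_fun setT (fun w => (p w).2 : R) &
      {ae P, forall w, epigraph h w (p w)}].

Definition glue (A : set Omega) (p p' : Omega -> V) (w : Omega) : V :=
  if w \in A then p w else p' w.

Lemma measurable_if_mem (A : set Omega) (f g : Omega -> R) :
  measurable A -> measurable_fun setT f -> measurable_fun setT g ->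
  measurable_fun setT (fun w => if w \in A then f w else g w).
Proof.
move=> mA mf mg; apply: measurable_fun_ifT => //.
by apply: (measurable_fun_bool true); rewrite setTI preimage_mem_true.
Qed.

(** Decomposability of the bounded strategies. Since [p] has to be bounded on [A] only, an unbounded
    selection can be truncated this way. *)
Lemma bounded_selection_glue A p p' M : measurable A ->
  measurable_vector (fun w => (p w).1) -> measurable_fun setT (fun w => (p w).2 : R) ->
  {ae P, forall w, epigraph h w (p w)} ->
  {ae P, forall w, A w -> forall j, `|(p w).1 0 j| <= M} ->
  bounded_selection p' -> bounded_selection (glue A p p').
Proof.
move=> mA m1 m2 ep pM [/LpyP[m1' [M' pM']] m2' ep']; split.
- apply/LpyP; split.
    move=> j; rewrite (_ : (fun w => _) =
      (fun w => if w \in A then (p w).1 0 j else (p' w).1 0 j)).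
      exact: measurable_if_mem (m1 j) (m1' j).
    by apply/funext => w; rewrite /glue; case: ifP.
  exists (Num.max M M'); apply: filterS2 pM pM' => w pM pM' j.
  by rewrite /glue; case: ifPn; rewrite ?inE => Aw; rewrite le_max ?pM ?pM' ?orbT.
- rewrite (_ : (fun w => _) = (fun w => if w \in A then (p w).2 else (p' w).2)).
    exact: measurable_if_mem m2 m2'.
  by apply/funext => w; rewrite /glue; case: ifP.
- by apply: filterS2 ep ep' => w; rewrite /glue; case: ifP.
Qed.

Definition dual_gain (p : Omega -> V) (w : Omega) : R :=
  dot (p w).1 (v w) - (p w).2.

Lemma measurable_dual_gain p : measurable_vector (fun w => (p w).1) ->
  measurable_fun setT (fun w => (p w).2 : R) -> measurable_fun setT (dual_gain p).
Proof.
move=> m1 m2; apply: measurable_funB => //.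
by apply: measurable_dot => //; exact: Lp_measurable v_L1.
Qed.

(** Realizes the running maximum of the gains of [p0] and the first [k] candidates by an actual
    selection. *)
Fixpoint best_of (p0 : Omega -> V) (t : nat -> Omega -> V) (k : nat) : Omega -> V :=
  if k is k'.+1 then
    let z := best_of p0 t k' in
    glue [set w | dual_gain z w < dual_gain (t k') w] (t k') z
  else p0.

Lemma best_ofS_ge p0 t k w : dual_gain (best_of p0 t k) w <=
  dual_gain (best_of p0 t k.+1) w.
Proof.
rewrite /= {2}/dual_gain /glue; case: ifPn => [|_]; last exact: lexx.
by rewrite inE/= => /ltW.
Qed.

Lemma best_ofS_ge_candidate p0 t k w : dual_gain (t k) w <=
  dual_gain (best_of p0 t k.+1) w.
Proof.
rewrite /= {2}/dual_gain /glue; case: ifPn => [_|]; first exact: lexx.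
by rewrite notin_setE/= => /negP; rewrite -leNgt.
Qed.

Lemma bounded_selection_best_of p0 t k : bounded_selection p0 ->
  (forall i, bounded_selection (t i)) -> bounded_selection (best_of p0 t k).
Proof.
move=> b0 bt; elim: k => [//|k IH] /=.
have [/LpyP[m1 [M tM]] m2 et] := bt k.
apply: (@bounded_selection_glue _ _ _ M) => //.
  have [/Lp_measurable m1' m2' _] := IH.
  have := measurable_fun_ltr (measurable_dual_gain m1' m2') (measurable_dual_gain m1 m2).
  by move=> /(_ measurableT [set true]); rewrite setTI; exact.
by apply: filterS tM.
Qed.

Lemma nondecreasing_best_of p0 t w :
  {homo (fun k => dual_gain (best_of p0 t k) w) : k l / (k <= l)%N >-> k <= l}.
Proof. by apply/nondecreasing_seqP => k; exact: best_ofS_ge. Qed.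

(** The lower bound [g] yields an integrable majorant of [h (z w) w], and properness excludes the
    expectation [-oo], so [h] is integrable along [z]. The gain lies below
    [dot (z w) (v w) - h (z w) w], whose integral [hM] bounds. *)
Lemma integral_dual_gain_le p (g : Omega -> R) (M : R) :
  (forall z, Lp P +oo%E m z -> (Edot P z v - Eint P h z <= M%:E)%E) ->
  P.-integrable setT (EFin \o g) ->
  (forall w, g w <= dual_gain p w) ->
  bounded_selection p ->
  P.-integrable setT (EFin \o dual_gain p) /\
  (\int[P]_w (dual_gain p w)%:E <= M%:E)%E.
Proof.
move=> hM ig gp [zy m2 ep]; set z := fun w => (p w).1 in zy *.
have mz := Lp_measurable zy.
have mh := measurable_integrand h_normal mz.
have izv := integrable_dot zy v_L1.
have mgain := measurable_dual_gain mz m2.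
have iu : P.-integrable setT (fun w => (dot (z w) (v w))%:E - (g w)%:E)%E.
  exact: integrableB.
have hle : {ae P, forall w, (h (z w) w <= (dot (z w) (v w))%:E - (g w)%:E)%E}.
  apply: filterS ep => w; rewrite /epigraph/= => /le_trans; apply.
  by rewrite -EFinB lee_fin; have := gp w; rewrite /dual_gain /z; lra.
have ihp : P.-integrable setT (fun w => h (z w) w)^\+%E.
  apply: ae_le_integrable iu _; first exact: measurable_funepos.
  apply: filterS hle => w hle; rewrite gee0_abs// funeposE ge_max abse_ge0 andbT.
  exact: le_trans hle (lee_abs _).
have EhE : Eint P h z = (\int[P]_w h (z w) w)%E by rewrite /Eint /Ex asboolT.
have ih : P.-integrable setT (fun w => h (z w) w).
  apply: integrable_Ex_lt_gt => //; first exact: (h_proper.1 z zy).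
  rewrite -/(Eint P h z) EhE; apply: (@le_lt_trans _ _ _ _ _ (ae_le_integral _ _ hle)) => //.
    exact: (measurable_int _ iu).
  exact: integrable_lty.
have izh : P.-integrable setT (fun w => (dot (z w) (v w))%:E - h (z w) w)%E.
  exact: integrableB.
have gle : {ae P, forall w, ((dual_gain p w)%:E <= (dot (z w) (v w))%:E - h (z w) w)%E}.
  by apply: filterS ep => w ep; rewrite /dual_gain EFinB; apply: leeB.
split.
  apply: (ae_sandwich_integrable _ ig izh); first exact/measurable_EFinP.
  by apply: filterS gle => w ->; rewrite /= lee_fin gp.
apply: le_trans (hM z zy).
rewrite Edot_integral// EhE -integralB//; apply: ae_le_integral => //.
  exact/measurable_EFinP.
exact: (measurable_int _ izh).
Qed.

Lemma exists_integrable_selection :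
  exists2 z, Lp P +oo%E m z & P.-integrable setT (fun w => h (z w) w).
Proof.
have [h_gt [z zy Ehz]] := h_proper; exists z => //.
apply: integrable_Ex_lt_gt => //; last exact: h_gt.
by apply: measurable_integrand => //; exact: Lp_measurable zy.
Qed.

(** A bounded strategy of finite cost provides an integrable minorant of the conjugate. *)
Lemma conj_integrable_of_lty : (Eint P (conj_integrand h) v < +oo)%E ->
  P.-integrable setT (fun w => conj_integrand h (v w) w).
Proof.
move=> /Ex_lty ip; have [z zy ihz] := exists_integrable_selection.
have mc := measurable_conj_integrand h_normal (Lp_measurable v_L1).
apply: (funepos_integrable_minorant mc ip (integrableB _ (integrable_dot zy v_L1) ihz)) => //.
by apply: nearW => w; exact: conj_integrand_ge.
Qed.

Lemma Eint_conj_gtNy : (-oo < Eint P (conj_integrand h) v)%E.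
Proof.
have [Elt|] := ltP (Eint P (conj_integrand h) v) +oo%E; last exact: lt_le_trans.
have ic := conj_integrable_of_lty Elt.
by rewrite /Eint Ex_integrable// ltNye_eq integrable_fin_num.
Qed.

Lemma Eint_conj_le (M : R) :
  (forall z, Lp P +oo%E m z -> (Edot P z v - Eint P h z <= M%:E)%E) ->
  (Eint P (conj_integrand h) v <= M%:E)%E.
Proof.
move=> hM; have mv := Lp_measurable v_L1; have [h_closed h_meas] := h_normal.
have [z0 z0y ih0] := exists_integrable_selection.
have mz0 := Lp_measurable z0y.
(* The fallback outside the truncation sets; its gain is the integrable lower bound of all later
   gains. *)
pose p0 w : V := (z0 w, fine (h (z0 w) w)).
have fin0 : {ae P, forall w, h (z0 w) w \is a fin_num}.
  by have := integrable_ae measurableT ih0; apply: filterS => w; exact.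
have b0 : bounded_selection p0.
  split => //.
    by apply: measurableT_comp => //; exact: measurable_integrand.
  by apply: filterS fin0 => w fw; rewrite /epigraph/= fineK.
have [y [yS my1 my2 yd]] := castaing_representation h_closed h_meas.
have S0 : {ae P, forall w, epigraph h w !=set0}.
  by case: b0 => _ _; apply: filterS => w Sw; exists (p0 w).
have yS' i : {ae P, forall w, epigraph h w (y i w)} by apply: filterS S0 => w; exact: yS.
(* Every selection is paired with every truncation level, so each value [y i w] is attained by some
   candidate. *)
pose A (il : nat * nat) := [set w | forall j, `|(y il.1 w).1 0 j| <= il.2%:R].
pose t n := let il := odflt (0, 0)%N (unpickle n) in glue (A il) (y il.1) p0.
have bt n : bounded_selection (t n).
  rewrite /t; case: (odflt _ _) => i l /=.
  apply: (@bounded_selection_glue _ _ _ l%:R) => //; last exact: nearW.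
  rewrite (_ : A _ = \bigcap_(j in [set: 'I_m]) [set w | `|(y i w).1 0 j| <= l%:R]).
    apply: fin_bigcap_measurable; first exact: finite_finset.
    move=> j _; have mn : measurable_fun setT (fun w => `|(y i w).1 0 j|).
      by apply: measurableT_comp => //; exact: my1.
    have := measurable_fun_ler mn (measurable_cst (l%:R : R)).
    by move=> /(_ measurableT [set true]); rewrite setTI; exact.
  by apply/seteqP; split => w /= Aw j; [move=> _|]; exact: Aw.
pose G k := dual_gain (best_of p0 t k).
have bz k : bounded_selection (best_of p0 t k) by exact: bounded_selection_best_of.
have ndG := @nondecreasing_best_of p0 t.
have i0v := integrable_dot z0y v_L1.
have iG0 : P.-integrable setT (EFin \o G 0%N).
  apply: (ae_le_integrable _ (integrableB measurableT i0v ih0)).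
    by apply/measurable_EFinP; case: b0 => /Lp_measurable ? ? _; exact: measurable_dual_gain.
  apply: filterS fin0 => w fw.
  have -> : (EFin \o G 0%N) w = ((dot (z0 w) (v w))%:E - h (z0 w) w)%E.
    by rewrite -[h (z0 w) w]fineK.
  exact: lexx.
have GP k : P.-integrable setT (EFin \o G k) /\ (\int[P]_w (G k w)%:E <= M%:E)%E.
  apply: (integral_dual_gain_le hM iG0 _ (bz k)) => w.
  exact: (ndG w 0%N k (leq0n k)).
(* Subtracting the initial gain makes the increasing sequence nonnegative, as monotone convergence
   requires. *)
pose g k w := (G k w - G 0%N w)%:E.
have mg k : measurable_fun setT (g k).
  apply/measurable_EFinP; apply: measurable_funB.
    by have [/(measurable_int _)/measurable_EFinP] := GP k.
  exact/measurable_EFinP/(measurable_int _ iG0).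
have g0 k w : (0 <= g k w)%E by rewrite lee_fin subr_ge0; exact: (ndG w 0%N k).
have ndg w : {homo g^~ w : k l / (k <= l)%N >-> (k <= l)%E}.
  by move=> k l kl; rewrite lee_fin lerD2r; exact: (ndG w).
pose L w := limn (g^~ w).
have cvg_int : (\int[P]_w g k w @[k --> \oo] --> \int[P]_w L w)%E.
  by apply: cvg_monotone_convergence => // w _; exact: ndg.
have gL k w : (g k w <= L w)%E.
  rewrite /L (cvg_lim _ (ereal_nondecreasing_cvgn (ndg w)))//.
  by apply: ereal_sup_ubound; exists k.
have L0 w : (0 <= L w)%E by exact: le_trans (g0 0%N w) (gL _ _).
have mL : measurable_fun setT L.
  apply: (emeasurable_fun_cvg g) => // w _; exact: ereal_nondecreasing_is_cvgn.
have intL : (\int[P]_w L w <= M%:E - \int[P]_w (G 0%N w)%:E)%E.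
  apply: cvge_le cvg_int; apply: nearW => k.
  under eq_integral do rewrite /g EFinB.
  have [iGk Gk] := GP k; rewrite integralB//; exact: leeB.
have iL : P.-integrable setT L.
  apply/integrableP; split => //; under eq_integral do rewrite gee0_abs//.
  apply: le_lt_trans intL _; have /fineK <- := integrable_fin_num measurableT iG0.
  by rewrite -EFinB ltry.
have iLG : P.-integrable setT (fun w => L w + (G 0%N w)%:E)%E by exact: integrableD.
have cL : {ae P, forall w, (conj_integrand h (v w) w <= L w + (G 0%N w)%:E)%E}.
  apply: filterS S0 => w Sw.
  rewrite (@conj_integrand_dense _ _ _ _ h (y ^~ w))//.
  - apply: ge_ereal_sup => _ [i _ <-].
    (* A level above the norm, at which the truncation is inactive at [w]. *)
    pose l := (Num.trunc `|(y i w).1|).+1.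
    pose n := pickle (i, l).
    have tn : t n w = y i w.
      rewrite /t pickleK /= /glue ifT// inE /A/= => j.
      by apply: le_trans (coord_le_norm _ _) _; apply/ltW; rewrite truncnS_gt.
    have := best_ofS_ge_candidate p0 t n w; rewrite {1}/dual_gain tn => le1.
    apply: (@le_trans _ _ (g n.+1 w + (G 0%N w)%:E)%E); last by rewrite leeD2r.
    by rewrite -EFinD lee_fin subrK.
  - by move=> i; exact: yS.
  - by move=> p e; exact: yd.
have mc := measurable_conj_integrand h_normal mv.
have ic : P.-integrable setT (fun w => conj_integrand h (v w) w).
  apply: (ae_sandwich_integrable mc (integrableB measurableT i0v ih0) iLG).
  by apply: filterS cL => w ->; rewrite andbT; exact: conj_integrand_ge.
rewrite /Eint Ex_integrable//; apply: le_trans (ae_le_integral mc _ cL) _.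
  exact: (measurable_int _ iLG).
rewrite integralD//; apply: le_trans (leeD2r _ intL) _.
have /fineK <- := integrable_fin_num measurableT iG0.
by rewrite -EFinB -EFinD subrK.
Qed.

End Interchange.

(** * Adapted strategies *)

Section SubSigmaAlgebra.
Context {T : pointedType} {R : realType}.
Variable G : set (set T).
Hypothesis G_sigma : sigma_algebra setT G.

Definition sub_measurable (f : T -> R) : Prop :=
  forall B, measurable B -> G (f @^-1` B).

(** A sigma-algebra generates itself, so the closure properties of measurable functions apply to
    [G]. *)
Lemma sub_measurableP (f : T -> R) : sub_measurable f <->
  @measurable_fun _ _ (g_sigma_algebraType G) R setT f.
Proof.
split=> [fG _ B mB|mf B mB].
  by rewrite setTI; apply: sub_sigma_algebra; exact: fG.
have := mf measurableT B mB; rewrite setTI /measurable/=.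
by rewrite sigma_algebra_id.
Qed.

Lemma sub_measurable_lin (f g : T -> R) (c : R) :
  sub_measurable f -> sub_measurable g -> sub_measurable (fun w => f w + c * g w).
Proof.
move=> /sub_measurableP mf /sub_measurableP mg; apply/sub_measurableP.
by apply: measurable_funD => //; exact: measurable_funM.
Qed.

Lemma sub_measurable_cst (c : R) : sub_measurable (cst c).
Proof. by apply/sub_measurableP; exact: measurable_cst. Qed.

Lemma sub_measurable_restrict (f : T -> R) C : G C ->
  sub_measurable f -> sub_measurable (fun w => if w \in C then f w else 0).
Proof.
move=> GC /sub_measurableP mf; apply/sub_measurableP.
apply: measurable_fun_ifT => //.
apply: (measurable_fun_bool true); rewrite setTI preimage_mem_true.
exact: sub_sigma_algebra.
Qed.

End SubSigmaAlgebra.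

Section AdaptedStrategies.
Context {d : measure_display} {Omega : measurableType d} {R : realType}.
Variables (P : probability Omega R) (T : nat).
Variables (F : 'I_T.+1 -> set (set Omega)) (n : 'I_T.+1 -> nat).
Hypothesis HF : filtration F.
Local Notation N := (\sum_t n t)%N.
Local Notation vec := ('rV[R]_N).

Lemma adapted_measurable (x : Omega -> vec) : adapted P F n x -> measurable_vector x.
Proof.
move=> ax j; have [mx _] := ax (tagnat.sig1 j).
move=> _ B mB; rewrite setTI; have := mx (tagnat.sig2 j) B mB.
by under eq_fun do rewrite mxE tagnat.sig2K.
Qed.

(** Adaptedness holds up to null sets, but truncation sets must lie in the sigma-algebra exactly,
    hence the passage to a version. [tagnat.sig1 j] is the period of the flat coordinate [j], and
    [tagnat.sig2 j] its place in the block. *)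
Lemma adapted_version (x : Omega -> vec) : adapted P F n x ->
  exists X : 'I_N -> Omega -> R,
    (forall j, sub_measurable (F (tagnat.sig1 j)) (X j)) /\
    {ae P, forall w, forall j, x w 0 j = X j w}.
Proof.
move=> ax.
have /choice[y yP] : forall j : 'I_N, exists f : Omega -> R,
    sub_measurable (F (tagnat.sig1 j)) f /\ {ae P, forall w, x w 0 j = f w}.
  move=> j; have [_ [y Fy xy]] := ax (tagnat.sig1 j).
  exists (fun w => y w 0 (tagnat.sig2 j)); split; first exact: Fy.
  by apply: filterS xy => w /(_ Logic.I) <-; rewrite mxE tagnat.sig2K.
exists y; split; first by move=> j; case: (yP j).
by apply: filter_forall => j; case: (yP j).
Qed.

Lemma adapted_of_version (x : Omega -> vec) (X : 'I_N -> Omega -> R) :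
  measurable_vector x ->
  (forall j, sub_measurable (F (tagnat.sig1 j)) (X j)) ->
  {ae P, forall w, forall j, x w 0 j = X j w} -> adapted P F n x.
Proof.
move=> mx FX xX t; split.
  move=> j B mB; rewrite -[X in measurable X]setTI; under eq_fun do rewrite mxE.
  exact: mx.
exists (fun w => \row_i X (tagnat.Rank t i) w).
  move=> j B mB; under eq_fun do rewrite mxE.
  by have := FX (tagnat.Rank t j) B mB; rewrite tagnat.Rank1K.
apply: filterS xX => w xX _; apply/rowP => i; rewrite !mxE; exact: xX.
Qed.

Lemma adapted0 : adapted P F n (cst 0).
Proof.
have [Fs _ _] := HF.
apply: (@adapted_of_version _ (fun j => cst 0)) => [j|j|].
- by under eq_fun do rewrite mxE; exact: measurable_cst.
- exact: sub_measurable_cst.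
- by apply: nearW => w j; rewrite mxE.
Qed.

Lemma adaptedDZ (x z : Omega -> vec) (c : R) : adapted P F n x -> adapted P F n z ->
  adapted P F n (fun w => x w + c *: z w).
Proof.
have [Fs _ _] := HF; move=> ax az.
have [X [FX xX]] := adapted_version ax.
have [Z [FZ zZ]] := adapted_version az.
apply: (@adapted_of_version _ (fun j w => X j w + c * Z j w)) => [j|j|].
- under eq_fun do rewrite !mxE.
  apply: measurable_funD; first exact: adapted_measurable.
  by apply: measurable_funM => //; exact: adapted_measurable.
- exact: sub_measurable_lin.
- by apply: filterS2 xX zZ => w xX zZ j; rewrite !mxE xX zZ.
Qed.

(** Orthogonality is tested on the strategy equal to [f] on [C] in coordinate [j] and zero
    otherwise. This supplies the zero integrals required by [integral_adapted_sum]. *)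
Lemma perp_coordinate (v : Omega -> vec) (j : 'I_N) (f : Omega -> R) C (k : R) :
  adapted_perp P F n v -> sub_measurable (F (tagnat.sig1 j)) f ->
  F (tagnat.sig1 j) C -> (forall w, C w -> `|f w| <= k) ->
  P.-integrable C (fun w => (f w * v w 0 j)%:E) /\
  (\int[P]_(w in C) (f w * v w 0 j)%:E = 0)%E.
Proof.
have [Fs Fm _] := HF; move=> [v1 vperp] Ff FC fk.
have mC : measurable C by exact: Fm FC.
pose g w := if w \in C then f w else 0.
have Fg : sub_measurable (F (tagnat.sig1 j)) g by exact: sub_measurable_restrict.
have mg : measurable_fun setT g.
  by move=> _ B mB; rewrite setTI; apply: Fm; exact: Fg.
pose z w : vec := \row_i (if i == j then g w else 0).
have mz : measurable_vector z.
  move=> i; under eq_fun do rewrite mxE.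
  by case: eqP => _ //; exact: measurable_cst.
have zy : Lp P +oo%E N z.
  (* If [C] is empty, [k] may be negative, hence the absolute value. *)
  apply/LpyP; split => //; exists `|k|; apply: nearW => w i; rewrite mxE.
  case: eqP => _; last by rewrite normr0.
  rewrite /g; case: ifPn; rewrite ?normr0// inE => /fk fwk.
  exact: le_trans fwk (ler_norm _).
have az : adapted P F n z.
  apply: (@adapted_of_version _ (fun i => if i == j then g else cst 0)) => [//|i|].
    by case: eqP => [->//|_]; exact: sub_measurable_cst.
  by apply: nearW => w i; rewrite mxE; case: eqP.
have zvE : (fun w => (dot (z w) (v w))%:E) =
    ((fun w => (f w * v w 0 j)%:E) \_ C).
  apply/funext => w; rewrite /dot (bigD1 j)//= [X in (_ + X)%:E]big1 ?addr0; last first.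
    by move=> i /negbTE ij; rewrite mxE ij mul0r.
  by rewrite mxE eqxx patchE /g; case: ifP => //; rewrite mul0r.
have izv := integrable_dot zy v1.
have := vperp z az zy; rewrite Edot_integral//.
rewrite zvE -integral_mkcond => I0; split => //.
by apply/integrable_mkcond => //; rewrite -zvE.
Qed.

Lemma pairwise_leq_enum m : pairwise (fun i j : 'I_m => (i <= j)%N) (enum 'I_m).
Proof.
rewrite -(pairwise_map val (fun i j => (i <= j)%N)) val_enum_ord.
by rewrite -sorted_pairwise ?iota_sorted//; exact: leq_trans.
Qed.

Lemma integral_dot_perp (x z v : Omega -> vec) :
  adapted P F n x -> Lp P +oo%E N z -> adapted_perp P F n v ->
  P.-integrable setT (fun w => (dot (x w + z w) (v w))%:E)^\+%E ->
  P.-integrable setT (fun w => (dot (x w + z w) (v w))%:E) /\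
  (\int[P]_w (dot (x w + z w) (v w))%:E = Edot P z v)%E.
Proof.
have [Fs Fm FF] := HF; move=> ax zy vperp ip.
have [v1 _] := vperp; have mv := Lp_measurable v1.
have mx := adapted_measurable ax; have mz := Lp_measurable zy.
have mxz : measurable_vector (fun w => x w + z w).
  by move=> j; under eq_fun do rewrite mxE; exact: measurable_funD.
have [X [FX xX]] := adapted_version ax.
pose Y w := dot (z w) (v w) + \sum_(j <- enum 'I_N) X j w * v w 0 j.
have xY : {ae P, forall w, dot (x w + z w) (v w) = Y w}.
  apply: filterS xX => w xX; rewrite /Y big_enum /= /dot -big_split/=.
  by apply: eq_bigr => j _; rewrite mxE mulrDl addrC xX.
have mX j : measurable_fun setT (X j).
  by move=> _ B mB; rewrite setTI; apply: Fm; exact: FX.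
have mY : measurable_fun setT Y.
  apply: measurable_funD; first exact: measurable_dot.
  by apply: measurable_sum => j; apply: measurable_funM.
have mxzv : measurable_fun setT (fun w => (dot (x w + z w) (v w))%:E).
  by apply/measurable_EFinP; exact: measurable_dot.
(* Flat coordinates run through the blocks in time order, so their sigma-algebras increase along the
   enumeration. The integrable base term is the product of [z] and [v]. *)
have [] := @integral_adapted_sum _ _ _ P 'I_N (fun i j => (i <= j)%N)
  (fun j => F (tagnat.sig1 j)) X (fun j w => v w 0 j) (enum 'I_N)
  (fun j => Fs _) (fun j => Fm _) _ FX mv
  (fun j C k => perp_coordinate vperp (FX j)) (pairwise_leq_enum N)
  setT (fun w => dot (z w) (v w)) measurableT _ (integrable_dot zy v1).
- by move=> i j ij; apply: FF; exact: tagnat.le_sig1.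
- move=> j _; have [F0 FC _] := Fs (tagnat.sig1 j).
  by rewrite -(setD0 setT); exact: FC.
- apply: ae_le_integrable ip _; first exact/measurable_funepos/measurable_EFinP.
  by apply: filterS xY => w xYw; rewrite !funeposE /= xYw.
move=> iY YE; split.
  by apply: ae_le_integrable iY _ => //; apply: filterS xY => w ->.
rewrite Edot_integral// -YE; apply: ae_eq_integral => //.
  exact/measurable_EFinP.
by apply: filterS xY => w -> _.
Qed.

End AdaptedStrategies.

(** * Duality *)

Section Duality.
Context {d : measure_display} {Omega : measurableType d} {R : realType}.
Variables (P : probability Omega R) (T : nat).
Variables (F : 'I_T.+1 -> set (set Omega)) (n : 'I_T.+1 -> nat).
Local Notation vec := ('rV[R]_(\sum_t n t)).
Variable h : vec -> Omega -> \bar R.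
Hypothesis HF : filtration F.
Hypothesis h_normal : normal_integrand h.
Hypothesis h_proper : proper_on_Linfty P h.
Hypothesis phi0_fin : value_fun P F h (cst 0) \is a fin_num.

Let phi := value_fun P F h.
Let hstar := conj_integrand h.

(** Finiteness of [c] makes this rearrangement safe for infinite [a] and [b]. *)
Lemma young_swap (a b : \bar R) (c : R) : (c%:E - a <= b -> c%:E - b <= a)%E.
Proof.
case: a b => [a| |] [b| |] //=; rewrite ?leNye ?leey//.
by rewrite -!EFinB !lee_fin; lra.
Qed.

(** Gives the integrable majorant of the positive part of the product of [x + z] and [v]. The
    subtracted form of the premise also covers opposite infinities. *)
Lemma young_pos (a b : \bar R) (c : R) :
  (c%:E - a <= b -> maxe c%:E 0 <= maxe a 0 + maxe b 0)%E.
Proof.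
have a0 : (0 <= maxe a 0)%E by rewrite le_max lexx orbT.
have b0 : (0 <= maxe b 0)%E by rewrite le_max lexx orbT.
have aa : (a <= maxe a 0)%E by rewrite le_max lexx.
have bb : (b <= maxe b 0)%E by rewrite le_max lexx.
move=> cab; rewrite ge_max adde_ge0// andbT.
have ab := leeD aa bb.
have a1 : (a <= maxe a 0 + maxe b 0)%E by apply: (le_trans aa); rewrite leeDl.
have b1 : (b <= maxe a 0 + maxe b 0)%E by apply: (le_trans bb); rewrite leeDr.
move: (maxe a 0 + maxe b 0)%E ab a1 b1 cab => s.
case: a {aa a0} => [a| |]; case: b {bb b0} => [b| |] //= ab a1 b1;
  try by move=> _; apply: le_trans a1; rewrite leey.
- by rewrite -EFinB lee_fin => ?; apply: le_trans ab; rewrite -EFinD lee_fin; lra.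
- by move=> _; apply: le_trans b1; rewrite leey.
- by move=> _; apply: le_trans b1; rewrite leey.
Qed.

Lemma value_fun_le (x z : Omega -> vec) : adapted P F n x ->
  (phi z <= Eint P h (fun w => (x w + z w)%R))%E.
Proof. by move=> ax; apply: ereal_inf_lbound; exists x. Qed.

Lemma value_fun0_le (x : Omega -> vec) : adapted P F n x ->
  (phi (cst 0%R) <= Eint P h x)%E.
Proof.
move=> ax; have := value_fun_le (cst 0) ax.
by rewrite (_ : (fun w => _) = x)//; apply/funext => w; rewrite addr0.
Qed.

Lemma Lpy0 : Lp P +oo%E (\sum_t n t) (cst 0).
Proof.
apply/LpyP; split; first by move=> j; under eq_fun do rewrite mxE; exact: measurable_cst.
by exists 0; apply: nearW => w j; rewrite mxE normr0.
Qed.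

Lemma Edot0 (v : Omega -> vec) : Edot P (cst 0) v = 0%E.
Proof.
rewrite /Edot (_ : (fun w => _) = cst 0%E).
  by rewrite Ex_integrable ?integral0//; exact: integrable0.
apply/funext => w; congr EFin; rewrite /dot.
by apply: big1 => j _; rewrite mxE mul0r.
Qed.

(** The order matters: the conjugate is integrable by properness, [young_pos] controls the positive
    part of the product, orthogonality then makes the product integrable, and product minus
    conjugate is an integrable minorant of [h]. *)
Lemma fenchel_adapted (x z v : Omega -> vec) :
  adapted P F n x -> Lp P +oo%E _ z -> adapted_perp P F n v ->
  (Eint P h (fun w => x w + z w)%R < +oo)%E -> (Eint P hstar v < +oo)%E ->
  [/\ P.-integrable setT (fun w => h (x w + z w) w),
      P.-integrable setT (fun w => hstar (v w) w),
      P.-integrable setT (fun w => (dot (x w + z w) (v w))%:E) &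
      (\int[P]_w (dot (x w + z w) (v w))%:E = Edot P z v)%E].
Proof.
move=> ax zy vperp Eh Ehs; have [v1 _] := vperp.
have mv := Lp_measurable v1.
have mxz : measurable_vector (fun w => x w + z w).
  move=> j; under eq_fun do rewrite mxE.
  by apply: measurable_funD; [exact: (adapted_measurable ax)|exact: (Lp_measurable zy)].
have ihs := conj_integrable_of_lty h_normal h_proper v1 Ehs.
have ihp := Ex_lty Eh; have ihsp := Ex_lty Ehs.
have mdot : measurable_fun setT (fun w => (dot (x w + z w) (v w))%:E).
  by apply/measurable_EFinP; exact: measurable_dot.
have young w := conj_integrand_ge h (v w) (x w + z w) w.
have [] := integral_dot_perp HF ax zy vperp.
  have isum := integrableD measurableT ihp ihsp.
  apply: ae_le_integrable isum _; first exact: measurable_funepos.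
  apply: nearW => w; rewrite gee0_abs// gee0_abs ?adde_ge0//.
  by rewrite !funeposE; exact: young_pos (young w).
move=> ixz ixzE; split => //.
apply: (funepos_integrable_minorant _ ihp (integrableB measurableT ixz ihs)).
  exact: measurable_integrand.
by apply: nearW => w; exact: young_swap (young w).
Qed.

Lemma weak_duality (x z v : Omega -> vec) :
  adapted P F n x -> Lp P +oo%E _ z -> adapted_perp P F n v ->
  (Edot P z v - Eint P h (fun w => x w + z w)%R <= Eint P hstar v)%E.
Proof.
move=> ax zy vperp; have [v1 _] := vperp.
have [Eh|] := ltP (Eint P h (fun w => x w + z w)) +oo%E; last first.
  by rewrite leye_eq => /eqP ->; rewrite addeNy leNye.
have [Ehs|] := ltP (Eint P hstar v) +oo%E; last by rewrite leye_eq => /eqP ->; rewrite leey.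
have [ih ihs ixz <-] := fenchel_adapted ax zy vperp Eh Ehs.
rewrite /Eint !Ex_integrable// -integralB//; apply: ae_le_integral.
- by apply: (@measurable_int _ _ _ P); exact: integrableB.
- exact: (@measurable_int _ _ _ P).
- by apply: nearW => w; exact: conj_integrand_ge.
Qed.

Lemma conjugate_ge (v z : Omega -> vec) : Lp P +oo%E _ z ->
  (Edot P z v - phi z <= conjugate P phi v)%E.
Proof. by move=> zy; apply: ereal_sup_ubound; exists z. Qed.

Lemma Eint_conj_le_conjugate (v : Omega -> vec) : Lp P 1%E _ v ->
  (Eint P hstar v <= conjugate P phi v)%E.
Proof.
move=> v1; case E : (conjugate P phi v) => [M| |]; last 2 first.
- by rewrite leey.
(* Testing [z = 0] bounds the conjugate below by the finite number [- phi 0]. *)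
- have := conjugate_ge v Lpy0; rewrite E leeNy_eq Edot0 sub0e.
  by rewrite -/phi; move: phi0_fin; rewrite -/phi; case: (phi _).
apply: Eint_conj_le => // z zy; rewrite -E.
apply: le_trans (conjugate_ge v zy); apply: leeB => //.
have := value_fun_le z (adapted0 P n HF).
by rewrite (_ : (fun w => _) = z)//; apply/funext => w; rewrite add0r.
Qed.

Lemma conjugate_value_fun (v : Omega -> vec) : Lp P 1%E _ v ->
  conjugate P phi v = (Eint P hstar v + indicator_fun R (adapted_perp P F n) v)%E.
Proof.
move=> v1; rewrite /indicator_fun; case: asboolP => vperp; last first.
  rewrite addey ?gt_eqF ?(Eint_conj_gtNy h_normal h_proper v1)//.
  have [z [az zy zv]] : exists z, [/\ adapted P F n z, Lp P +oo%E _ z & Edot P z v <> 0%E].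
    apply: contrapT => nz; apply: vperp; split => // z az zy.
    by apply: contrapT => zv; apply: nz; exists z.
  apply/eqyP => A A0.
  have zvfin := Edot_fin_num zy v1.
  pose e := fine (Edot P z v).
  have eE : Edot P z v = e%:E by rewrite fineK.
  have e0 : e != 0 by apply/eqP => e0; apply: zv; rewrite eE e0.
  pose p := fine (phi (cst 0)).
  have pE : phi (cst 0) = p%:E by rewrite fineK.
  (* Chosen so that [l * e - p = A]. *)
  pose l := (A + p) / e.
  have lzy : Lp P +oo%E _ (fun w => l *: z w).
    move/LpyP: zy => [mz [M zM]]; apply/LpyP; split.
      by move=> j; under eq_fun do rewrite mxE; exact: measurable_funM.
    exists (`|l| * M); apply: filterS zM => w zM j.
    by rewrite mxE normrM ler_wpM2l.
  apply: le_trans (conjugate_ge v lzy).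
  have -> : Edot P (fun w => l *: z w) v = (l * e)%:E.
    rewrite Edot_integral// EFinM -eE Edot_integral//.
    rewrite -integralZl//; last exact: integrable_dot.
    apply: eq_integral => w _; rewrite -EFinM; congr EFin; rewrite /dot mulr_sumr.
    by apply: eq_bigr => j _; rewrite mxE mulrA.
  (* Replacing [x] by [x - l z] cancels the perturbation without leaving the adapted strategies. *)
  have : (phi (fun w => l *: z w)%R <= phi (cst 0%R))%E.
    apply: ereal_inf_le_tmp => _ [x ax <-].
    exists (fun w => x w + - l *: z w); first exact: adaptedDZ.
    by congr Eint; apply/funext => w; rewrite scaleNr subrK addr0.
  rewrite pE => le_p; apply: (@le_trans _ _ ((l * e)%:E - p%:E)%E).
    by rewrite -EFinB lee_fin /l divfK//; lra.
  exact: leeB.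
rewrite adde0; apply/eqP; rewrite eq_le Eint_conj_le_conjugate// andbT.
apply: ge_ereal_sup => _ [z zy <-].
(* The swap isolates [phi z], so that weak duality can be applied under its infimum. *)
have /fineK <- := Edot_fin_num zy v1; apply: young_swap.
apply: le_ereal_inf_tmp => _ [x ax <-].
by apply: young_swap; rewrite fineK ?Edot_fin_num//; exact: weak_duality.
Qed.

(** A shadow price is a [v] for which [z = 0] attains the supremum defining the conjugate. *)
Lemma shadow_priceP (v : Omega -> vec) : Lp P 1%E _ v ->
  (shadow_price P phi v <-> conjugate P phi v = - phi (cst 0%R))%E.
Proof.
move=> v1; have /fineK pE := phi0_fin; rewrite -/phi in pE.
split=> [sp|cE z zy].
  apply/eqP; rewrite eq_le; apply/andP; split; last first.
    by have := conjugate_ge v Lpy0; rewrite Edot0 sub0e.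
  apply: ge_ereal_sup => _ [z zy <-].
  have := sp z zy; have /fineK <- := Edot_fin_num zy v1; rewrite -pE.
  case: (phi z) => [r| |] //=; rewrite ?leNye//.
  by rewrite !lee_fin; lra.
have := conjugate_ge v zy; rewrite cE; have /fineK <- := Edot_fin_num zy v1.
rewrite -pE; case: (phi z) => [r| |] //=; rewrite ?leey//.
by rewrite !lee_fin; lra.
Qed.

Lemma shadow_price_dual (v : Omega -> vec) : Lp P 1%E _ v ->
  (shadow_price P phi v <->
   adapted_perp P F n v /\ Eint P hstar v = (- phi (cst 0%R))%E).
Proof.
move=> v1; rewrite shadow_priceP// conjugate_value_fun// /indicator_fun.
have /fineK pE := phi0_fin; rewrite -/phi in pE.
case: asboolP => vperp; first by rewrite adde0; split => [|[]].
(* Without orthogonality the conjugate is [+oo], whereas [- phi 0] is finite. *)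
split=> [|[]//]; rewrite addey ?gt_eqF ?(Eint_conj_gtNy h_normal h_proper v1)//.
by rewrite -pE.
Qed.

Lemma dual_value_ge (v : Omega -> vec) : adapted_perp P F n v ->
  (- phi (cst 0%R) <= Eint P hstar v)%E.
Proof.
move=> vperp; have [v1 _] := vperp.
have := conjugate_ge v Lpy0; rewrite conjugate_value_fun// /indicator_fun asboolT//.
by rewrite adde0 Edot0 sub0e.
Qed.

(** For an adapted [x] of finite cost, product minus conjugate integrates to [phi 0] and lies below
    [h (x w) w]. Optimality is thus equality of two integrals of ordered functions, that is, almost
    sure equality in the Fenchel inequality. *)
Lemma shadow_price_optimality (v x : Omega -> vec) : Lp P 1%E _ v ->
  shadow_price P phi v -> adapted P F n x ->
  minimizes (Eint P h) (adapted P F n) x <->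
  (Eint P h x < +oo)%E /\
  {ae P, forall w, minimizes (fun xi => h xi w - (dot (v w) xi)%:E)%E setT (x w)}.
Proof.
move=> v1 /(shadow_price_dual v1)[vperp Ehs] ax.
have /fineK pE := phi0_fin; rewrite -/phi in pE.
have Ehs_lty : (Eint P hstar v < +oo)%E by rewrite Ehs -pE ltry.
have x0 : (fun w => x w + cst 0 w) = x by apply/funext => w; rewrite addr0.
have fenchel : (Eint P h x < +oo)%E ->
  [/\ P.-integrable setT (fun w => h (x w) w),
      P.-integrable setT (fun w => hstar (v w) w),
      P.-integrable setT (fun w => (dot (x w) (v w))%:E) &
      (\int[P]_w (dot (x w) (v w))%:E = 0)%E].
  move=> Ehx; have := fenchel_adapted ax Lpy0 vperp; rewrite x0 Edot0.
  move=> /(_ Ehx Ehs_lty)[i1 i2 i3 i4].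
  have xE w : x w + cst 0 w = x w by rewrite addr0.
  split => //.
  - by apply: eq_integrable i1 => // w _; rewrite xE.
  - by apply: eq_integrable i3 => // w _; rewrite xE.
  - by rewrite -i4; apply: eq_integral => w _; rewrite xE.
have dotC (a b : vec) : dot a b = dot b a.
  by apply: eq_bigr => j _; rewrite mulrC.
have intB : (Eint P h x < +oo)%E ->
    (\int[P]_w ((dot (x w) (v w))%:E - hstar (v w) w) = phi (cst 0%R))%E.
  move=> Ehx; have [i1 i2 i3 i4] := fenchel Ehx.
  rewrite integralB// i4 sub0e -(Ex_integrable i2).
  by rewrite -/(Eint P hstar v) Ehs oppeK.
split=> [[_ xmin]|[Ehx xmin]].
  have Ehx : Eint P h x = phi (cst 0%R).
    apply/eqP; rewrite eq_le value_fun0_le// andbT.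
    apply: le_ereal_inf_tmp => _ [y ay <-]; apply: xmin.
    by rewrite (_ : (fun w => _) = y)//; apply/funext => w; rewrite addr0.
  have Ehx_lty : (Eint P h x < +oo)%E by rewrite Ehx -pE ltry.
  split => //; have [i1 i2 i3 i4] := fenchel Ehx_lty.
  have young : {ae P, forall w,
      ((dot (x w) (v w))%:E - hstar (v w) w <= h (x w) w)%E}.
    by apply: nearW => w; apply: young_swap; exact: conj_integrand_ge.
  have intE : (\int[P]_w ((dot (x w) (v w))%:E - hstar (v w) w) =
      \int[P]_w h (x w) w)%E.
    by rewrite intB// -(Ex_integrable i1) -Ehx.
  have eqae := ae_eq_of_le_integral (integrableB measurableT i3 i2) i1 young intE.
  apply: filterS3 eqae (integrable_ae measurableT i1) (integrable_ae measurableT i2).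
  move=> w eqw /(_ Logic.I) hfin /(_ Logic.I) hsfin; split => // xi _.
  have := conj_integrand_ge h (v w) xi w; rewrite -/hstar !(dotC (v w)).
  move: eqw hfin hsfin; case: (h (x w) w) => // a; case: (hstar (v w) w) => // b.
  rewrite -EFinB => -[ab] _ _; case: (h xi w) => [r| |] //=; rewrite ?leey//.
  by rewrite -!EFinB !lee_fin; lra.
have [i1 i2 i3 i4] := fenchel Ehx.
split => // y ay; apply: le_trans (value_fun0_le ay).
rewrite /Eint Ex_integrable// -intB//; apply: ae_le_integral.
- exact: (@measurable_int _ _ _ P).
- by apply: (@measurable_int _ _ _ P); exact: integrableB.
apply: filterS2 xmin (integrable_ae measurableT i1) => w [_ xmin] /(_ Logic.I) hfin.
(* Pointwise minimality says that [x w] attains the supremum defining the conjugate. *)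
have : (hstar (v w) w <= (dot (x w) (v w))%:E - h (x w) w)%E.
  apply: ge_ereal_sup => _ [xi _ <-]; have := xmin xi Logic.I.
  rewrite !(dotC (v w)); move: hfin; case: (h (x w) w) => // a _.
  case: (h xi w) => [r| |] //=; rewrite ?leNye//.
  by rewrite -!EFinB !lee_fin; lra.
move: hfin; case: (h (x w) w) => // a _; case: (hstar (v w) w) => [b| |] //=.
  by rewrite -!EFinB !lee_fin; lra.
by rewrite leey.
Qed.

End Duality.

Theorem theorem1 (R : realType) (d : measure_display)
    (Omega : measurableType d) (P : probability Omega R)
    (T : nat) (F : 'I_T.+1 -> set (set Omega)) (n : 'I_T.+1 -> nat)
    (h : 'rV[R]_(\sum_t n t) -> Omega -> \bar R)
    (HF : filtration F)
    (hnormal : normal_integrand h)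
    (hconvex : convex_integrand h)
    (phi0_fin : value_fun P F h (cst 0) \is a fin_num)
    (hproper : proper_on_Linfty P h) :
  let phi := value_fun P F h in
  let Nperp := adapted_perp P F n in
  let Ehstar := Eint P (conj_integrand h) in
  [/\ forall v, Lp P 1%E _ v ->
        conjugate P phi v = (Ehstar v + indicator_fun R Nperp v)%E,
      forall v, Lp P 1%E _ v ->
        (shadow_price P phi v <->
         minimizes Ehstar Nperp v /\
         ereal_inf [set Ehstar u | u in Nperp] = (- phi (cst 0%R))%E)
    & forall v, Lp P 1%E _ v -> shadow_price P phi v ->
      forall x, adapted P F n x ->
        (minimizes (Eint P h) (adapted P F n) x <->
         (Eint P h x < +oo)%E /\
         {ae P, forall w,
            minimizes (fun xi => h xi w - (dot (v w) xi)%:E)%E setT (x w)})].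
Proof.
move=> phi Nperp Ehstar; split.
- by move=> v v1; exact: conjugate_value_fun.
(* Weak duality makes [- phi 0] a lower bound of the dual problem, so attaining this value means
   both being a minimizer and having no duality gap. *)
- move=> v v1; rewrite shadow_price_dual//; split=> [[vperp vE]|[[vperp vmin] infE]].
    split.
      by split => // u uperp; rewrite /Ehstar vE; exact: dual_value_ge.
    apply/eqP; rewrite eq_le; apply/andP; split.
      by rewrite -vE; apply: ereal_inf_lbound; exists v.
    by apply: le_ereal_inf_tmp => _ [u uperp <-]; exact: dual_value_ge.
  split => //; apply/eqP; rewrite eq_le dual_value_ge// andbT -infE.
  by apply: le_ereal_inf_tmp => _ [u uperp <-]; exact: vmin.
- by move=> v v1 vsp x ax; exact: shadow_price_optimality.
Qed.
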